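(* $\mathcal{R}(W_{1.5})=\mathrm{PSPACE}$: a language is recognized by a (nondeterministic-guess) multi-head 2-way automaton with an auxiliary read-only memory of model $W_{1.5}$ if and only if it is in $\mathrm{PSPACE}$.
   Context: The 1.5-way tape $W_{1.5}$ has cells $0,1,2,\dots$, initial cell $0$, and from each cell $n$ an edge $n\to n+1$ marked $+$ and an edge $n\to0$ marked $-$. An $h$-head automaton with auxiliary memory of model $W_{1.5}$ has a finite state set $Q$, input alphabet $\Sigma$ with endmarkers $\triangleleft,\triangleright$, a finite memory alphabet $\Delta$, a transition function mapping (state, the $h$ input symbols under its 2-way read-only heads, the symbol in the current memory cell) to (new state, a move in $\{-1,0,+1\}$ per head, and $+$, $-$ or ''stay'' for the memory position), an initial state and accepting states. On input $w$ (as $\triangleleft w\triangleright$) it starts in the initial state, heads at the leftmost symbol of $w$, memory at cell $0$, and runs deterministically for a fixed memory content $\mu\colon\{0,1,\dots\}\to\Delta$; it accepts $w$ iff for some memory content $\mu$ it reaches an accepting state. $\mathcal{R}(W_{1.5})$ is the class of languages recognized by such automata (any number of heads). *)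

(* Defs.v *)
From HB Require Import structures.
From mathcomp Require Import all_boot all_order all_algebra.
Set Implicit Arguments.
Unset Strict Implicit.
Unset Printing Implicit Defensive.

Definition language (Sigma : Type) := seq Sigma -> Prop.

Inductive endmarked (Sigma : Type) := LEnd | Sym of Sigma | REnd.
Arguments LEnd {Sigma}.
Arguments REnd {Sigma}.

Section EndmarkedFinite.
Variable Sigma : Type.
Definition endmarked_encode (x : endmarked Sigma) : Sigma + bool :=
  match x with Sym a => inl a | LEnd => inr false | REnd => inr true end.
Definition endmarked_decode (x : Sigma + bool) : endmarked Sigma :=
  match x with inl a => Sym a | inr false => LEnd | inr true => REnd end.
Lemma endmarked_encodeK : cancel endmarked_encode endmarked_decode.
Proof. by case. Qed.
End EndmarkedFinite.

HB.instance Definition _ (Sigma : finType) :=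
  Finite.copy (endmarked Sigma) (can_type (@endmarked_encodeK Sigma)).

(* The left endmarker is at position 0, the letters of w at 1 .. size w, and  *)
(* the right endmarker at (size w).+1.                                        *)
Definition input_at (Sigma : Type) (w : seq Sigma) (p : nat) : endmarked Sigma :=
  nth REnd (LEnd :: rcons (map (@Sym Sigma) w) REnd) p.

Inductive move := MoveL | Stay | MoveR.

(* A head on an endmarked input of length n cannot leave [0, n.+1]: a move    *)
(* beyond an endmarker leaves the head where it is.                           *)
Definition move_input (n : nat) (m : move) (p : nat) : nat :=
  match m with MoveL => p.-1 | Stay => p | MoveR => minn p.+1 n.+1 end.

(* Cells of W_1.5 are natural numbers, with edges n -> n.+1 and n -> 0.       *)
Inductive W15_mark := MarkPlus | MarkMinus.

Definition W15_edge (e : W15_mark) (n : nat) : nat :=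
  match e with MarkPlus => n.+1 | MarkMinus => 0 end.

(* In the memory component of a transition, None means staying in the cell.   *)
Record mem_automaton (Sigma : finType) (h : nat) := MemAutomaton {
  ma_state : finType;
  ma_mem : finType;
  ma_trans : ma_state -> {ffun 'I_h -> endmarked Sigma} -> ma_mem ->
             ma_state * {ffun 'I_h -> move} * option W15_mark;
  ma_init : ma_state;
  ma_acc : {set ma_state}
}.

Section MemAutomatonRun.
Variables (Sigma : finType) (h : nat) (A : mem_automaton Sigma h).

Record ma_conf := MaConf {
  mc_state : ma_state A;
  mc_heads : {ffun 'I_h -> nat};
  mc_cell : nat
}.

Definition ma_conf0 : ma_conf := MaConf (ma_init A) [ffun=> 1] 0.

Definition ma_step (w : seq Sigma) (mu : nat -> ma_mem A) (c : ma_conf) : ma_conf :=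
  let: (q, ms, e) :=
    ma_trans (mc_state c) [ffun i => input_at w (mc_heads c i)]
             (mu (mc_cell c)) in
  MaConf q [ffun i => move_input (size w) (ms i) (mc_heads c i)]
         (if e is Some m then W15_edge m (mc_cell c) else mc_cell c).

Definition ma_run (w : seq Sigma) (mu : nat -> ma_mem A) (t : nat) : ma_conf :=
  iter t (ma_step w mu) ma_conf0.

Definition ma_accepts (w : seq Sigma) : Prop :=
  exists mu : nat -> ma_mem A,
  exists t, mc_state (ma_run w mu t) \in ma_acc A.
End MemAutomatonRun.

Definition R_W15 (Sigma : finType) (L : language Sigma) : Prop :=
  exists h : nat, 0 < h /\
  exists A : mem_automaton Sigma h, forall w, L w <-> ma_accepts A w.

(* Deterministic off-line Turing machines: an endmarked two-way read-only     *)
(* input tape and k work tapes, infinite to the right only.                   *)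
Record turing_machine (Sigma : finType) (k : nat) := TuringMachine {
  tm_state : finType;
  tm_sym : finType;
  tm_blank : tm_sym;
  tm_trans : tm_state -> endmarked Sigma -> {ffun 'I_k -> tm_sym} ->
             tm_state * move * {ffun 'I_k -> tm_sym * move};
  tm_init : tm_state;
  tm_accept : tm_state;
  tm_reject : tm_state;
  tm_accept_neq_reject : tm_accept != tm_reject
}.

(* Moving left from cell 0 of a work tape leaves the head on cell 0.          *)
Definition move_work (m : move) (p : nat) : nat :=
  match m with MoveL => p.-1 | Stay => p | MoveR => p.+1 end.

Section TuringMachineRun.
Variables (Sigma : finType) (k : nat) (M : turing_machine Sigma k).

Record tm_conf := TmConf {
  tc_state : tm_state M;
  tc_input : nat;
  tc_heads : {ffun 'I_k -> nat};
  tc_tapes : 'I_k -> nat -> tm_sym M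
}.

Definition tm_conf0 : tm_conf :=
  TmConf (tm_init M) 1 [ffun=> 0] (fun _ _ => tm_blank M).

Definition tm_halted (c : tm_conf) : bool :=
  (tc_state c == tm_accept M) || (tc_state c == tm_reject M).

Definition tm_step (w : seq Sigma) (c : tm_conf) : tm_conf :=
  if tm_halted c then c else
  let: (q, m, act) :=
    tm_trans (tc_state c) (input_at w (tc_input c))
             [ffun j => tc_tapes c j (tc_heads c j)] in
  TmConf q (move_input (size w) m (tc_input c))
         [ffun j => move_work (act j).2 (tc_heads c j)]
         (fun j i => if i == tc_heads c j then (act j).1 else tc_tapes c j i).

Definition tm_run (w : seq Sigma) (t : nat) : tm_conf :=
  iter t (tm_step w) tm_conf0.

Definition tm_halts (w : seq Sigma) : Prop := exists t, tm_halted (tm_run w t).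

Definition tm_accepts (w : seq Sigma) : Prop :=
  exists t, tc_state (tm_run w t) = tm_accept M.

Definition tm_decides (L : language Sigma) : Prop :=
  forall w, tm_halts w /\ (L w <-> tm_accepts w).

(* On inputs of length n, at most S n cells of each work tape are scanned.    *)
Definition tm_space_bounded (S : nat -> nat) : Prop :=
  forall w t j, tc_heads (tm_run w t) j < S (size w).
End TuringMachineRun.

Definition DSPACE (S : nat -> nat) (Sigma : finType) (L : language Sigma) : Prop :=
  exists (k : nat) (M : turing_machine Sigma k),
    tm_decides M L /\ tm_space_bounded M S.

Definition PSPACE (Sigma : finType) (L : language Sigma) : Prop :=
  exists p : {poly nat}, DSPACE (fun n => p.[n]%R) L.

(* Main.v *)
Require Import Defs.
From HB Require Import structures.
From mathcomp Require Import all_boot all_order all_algebra zify.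
From Stdlib Require Import FunctionalExtensionality.
Set Implicit Arguments.
Unset Strict Implicit.
Unset Printing Implicit Defensive.

(* From PSPACE to W_1.5: the memory holds, for every step of the Turing machine,
   the symbols under its work heads.  For each cell y within the space bound one
   pass over the memory replays the computation and follows the contents of cell y
   of every tape, checking the claimed symbols whenever a head is on y; the passes
   together force the memory to be the true computation.  Positions up to a
   polynomial bound are counters in base n + 2 whose digits are heads.  A digit is
   read alternately upwards and downwards (boustrophedon), so that a carry reverses
   directions instead of rewinding heads and every increment is a single step.

   From W_1.5 to PSPACE: make every step of the automaton move on the memory and
   bound its resets by a counter.  Then w is accepted iff one can label the memory
   cells 0, 1, ..., l by sets of pairs (state, head positions), closed under the
   steps of the automaton for suitable memory symbols, the first containing the
   initial pair and the last being empty: the set at a cell lists the ways the run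
   visits it, and a + step leads to the next set while a reset leads to the first
   one.  A set has polynomial size, so l may be taken to be 2^K with K polynomial,
   and Savitch's halving turns the existence of the chain into an alternating game
   on words of polynomial length, whose outcome depends on one point of the grid of
   head positions, chosen last.  A Turing machine evaluates this game by running
   through all words in lexicographic order. *)

(** * Finite types of moves, and endmarkers as position tests *)

Definition move_encode (m : move) : 'I_3 :=
  match m with MoveL => @Ordinal 3 0 isT | Stay => @Ordinal 3 1 isT | MoveR => @Ordinal 3 2 isT end.
Definition move_decode (i : 'I_3) : move :=
  match val i with 0 => MoveL | 1 => Stay | _ => MoveR end.
Lemma move_encodeK : cancel move_encode move_decode.
Proof. by case. Qed.
HB.instance Definition _ := Finite.copy move (can_type move_encodeK).

Definition mark_encode (m : W15_mark) : bool := if m is MarkPlus then true else false.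
Definition mark_decode (b : bool) : W15_mark := if b then MarkPlus else MarkMinus.
Lemma mark_encodeK : cancel mark_encode mark_decode.
Proof. by case. Qed.
HB.instance Definition _ := Finite.copy W15_mark (can_type mark_encodeK).

Section InputAt.
Variables (Sigma : finType) (w : seq Sigma).
Let n := size w.

Lemma input_at_REnd p : (input_at w p == REnd) = (n < p).
Proof.
rewrite /input_at /n; case: p => [|p] //=.
rewrite nth_rcons size_map; case: (ltngtP p (size w)) => Hp.
- by case: w Hp => // a w' Hp; rewrite (nth_map a) // ltnS leqNgt Hp; apply/eqP.
- by rewrite ltnS (ltnW Hp); apply/eqP.
- by rewrite ltnS Hp leqnn; apply/eqP.
Qed.

Lemma input_at_LEnd p : (input_at w p == LEnd) = (p == 0).
Proof.
rewrite /input_at; case: p => [|p] //=.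
rewrite nth_rcons size_map; case: (ltngtP p (size w)) => Hp //.
case: w Hp => // a w' Hp; rewrite (nth_map a) //.
Qed.

Lemma move_input_le m p : p <= n.+1 -> move_input n m p <= n.+1.
Proof. by case: m => //= H; lia. Qed.
End InputAt.

(** * Boustrophedon counters *)

Definition dig (b p i : nat) : nat := (p %/ b ^ i) %% b.

Section Digits.
Variable b : nat.
Hypothesis b_gt1 : 1 < b.
Let b_gt0 : 0 < b := ltnW b_gt1.

Lemma dig_lt p i : dig b p i < b.
Proof. by rewrite ltn_mod. Qed.

Lemma dig_div p i : p %/ b ^ i = p %/ b ^ i.+1 * b + dig b p i.
Proof. by rewrite expnSr divnMA -divn_eq. Qed.

Lemma divS_exp p i : p.+1 %/ b ^ i = (b ^ i %| p.+1) + p %/ b ^ i.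
Proof. by rewrite divnS // expn_gt0 b_gt0. Qed.

Lemma dvdn_expS p i : (b ^ i.+1 %| p) = (b ^ i %| p) && (dig b p i == 0).
Proof.
apply/idP/andP => [H|[H1 H2]].
  have H1 : b ^ i %| p by apply: dvdn_trans H; rewrite expnS dvdn_mull.
  split=> //; rewrite /dig -/(_ %| _) dvdn_divRL // mulnC -expnSr //.
by move: H2; rewrite /dig -/(_ %| _) dvdn_divRL // mulnC -expnSr.
Qed.

Lemma digS p i : dig b p.+1 i =
  if b ^ i %| p.+1 then (if dig b p i == b.-1 then 0 else (dig b p i).+1) else dig b p i.
Proof.
rewrite {1}/dig divS_exp; case: ifP => _; last by rewrite add0n.
rewrite add1n -addn1 -modnDml addn1 -/(dig b p i).
have := dig_lt p i; case: eqP => [->|H] Hlt; first by rewrite prednK // modnn.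
by rewrite modn_small //; lia.
Qed.

Lemma dvdn_exp_digS p i : (b ^ i.+1 %| p.+1) = (b ^ i %| p.+1) && (dig b p i == b.-1).
Proof.
rewrite dvdn_expS digS; case: (b ^ i %| p.+1) => //=.
by case: (dig b p i == b.-1).
Qed.

Lemma dvdn_exp_low p i : (b ^ i %| p) = all (fun j => dig b p j == 0) (iota 0 i).
Proof.
elim: i => [|i IH]; first by rewrite expn0 dvd1n.
by rewrite dvdn_expS IH -addn1 iotaD all_cat /= andbT.
Qed.

Lemma dvdn_exp_lowS p i : (b ^ i %| p.+1) = all (fun j => dig b p j == b.-1) (iota 0 i).
Proof.
elim: i => [|i IH]; first by rewrite expn0 dvd1n.
by rewrite dvdn_exp_digS IH -addn1 iotaD all_cat /= andbT.
Qed.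

Lemma dig_mod p m i : i < m -> dig b (p %% b ^ m) i = dig b p i.
Proof.
move=> Him; rewrite /dig.
have -> : b ^ m = b ^ (m - i).-1 * b * b ^ i.
  by rewrite -expnSr -expnD; congr (_ ^ _); lia.
rewrite {2}(divn_eq p (b ^ (m - i).-1 * b * b ^ i)).
rewrite !mulnA divnMDl ?expn_gt0 ?b_gt0 //.
by rewrite modnMDl.
Qed.
End Digits.

Lemma all_iota_forall (m i : nat) (P : nat -> bool) : i <= m ->
  all P (iota 0 i) = [forall j : 'I_m, (j < i) ==> P j].
Proof.
move=> Him; apply/allP/forallP => [H j|H x].
  by apply/implyP => Hj; apply: H; rewrite mem_iota.
rewrite mem_iota /= add0n => Hx.
by have /implyP := H (Ordinal (leq_trans Hx Him)); apply.
Qed.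

(** The flag [s] marks a digit that is read downwards: its value is then the distance of its head
    from the right endmarker. Flipping the flag exchanges 0 and [n.+1] while the head rests. *)
Definition eff (n : nat) (s : bool) (v : nat) := if s then n.+1 - v else v.

Lemma effK n s v : v <= n.+1 -> eff n s (eff n s v) = v.
Proof. by case: s => //= H; rewrite /eff subKn. Qed.

Section Reflected.
Variables (Sigma : finType) (m : nat).
Implicit Types (s : {ffun 'I_m -> bool}) (y : {ffun 'I_m -> endmarked Sigma}).

Definition at_ext (up : bool) s y (i : 'I_m) : bool :=
  y i == (if up (+) s i then REnd else LEnd).
Definition all_ext up s y := [forall i, at_ext up s y i].
Definition carry up s y (i : 'I_m) := [forall j : 'I_m, (j < i) ==> at_ext up s y j].
(** A digit that overflows would have to send its head across the whole input. Instead [cnt_dir]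
    reverses its direction, which turns the maximal value into zero or back, and only the digit that
    absorbs the carry moves its head. *)
Definition cnt_move up s y : {ffun 'I_m -> move} :=
  [ffun i => if carry up s y i && ~~ at_ext up s y i
             then (if up (+) s i then MoveR else MoveL) else Stay].
Definition cnt_dir up s y : {ffun 'I_m -> bool} :=
  [ffun i => s i (+) (carry up s y i && at_ext up s y i)].

Variable w : seq Sigma.
Let n := size w.
Let b := n.+2.

Definition reflects s (v : 'I_m -> nat) (p : nat) :=
  forall i : 'I_m, v i <= n.+1 /\ eff n (s i) (v i) = dig b p i.

Definition seen (v : 'I_m -> nat) : {ffun 'I_m -> endmarked Sigma} :=
  [ffun i => input_at w (v i)].

Lemma at_ext_max s v p i : reflects s v p -> at_ext true s (seen v) i = (dig b p i == b.-1).
Proof.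
move=> /(_ i) [Hv <-]; rewrite /at_ext ffunE /eff; case: (s i) => /=.
  by rewrite input_at_LEnd /b /=; lia.
by rewrite input_at_REnd -/n /b /=; lia.
Qed.

Lemma at_ext_min s v p i : reflects s v p -> at_ext false s (seen v) i = (dig b p i == 0).
Proof.
move=> /(_ i) [Hv <-]; rewrite /at_ext ffunE /eff; case: (s i) => /=.
  by rewrite input_at_REnd -/n; lia.
by rewrite input_at_LEnd.
Qed.

Lemma carry_up s v p i : reflects s v p -> carry true s (seen v) i = (b ^ i %| p.+1).
Proof.
move=> H; rewrite dvdn_exp_lowS // (@all_iota_forall m) ?(ltnW (ltn_ord i)) //.
by apply: eq_forallb => j; rewrite (at_ext_max _ H).
Qed.

Lemma carry_down s v p i : reflects s v p -> carry false s (seen v) i = (b ^ i %| p).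
Proof.
move=> H; rewrite dvdn_exp_low // (@all_iota_forall m) ?(ltnW (ltn_ord i)) //.
by apply: eq_forallb => j; rewrite (at_ext_min _ H).
Qed.

Lemma all_ext_zero s v p : reflects s v p -> all_ext false s (seen v) = (b ^ m %| p).
Proof.
move=> H; rewrite dvdn_exp_low // (@all_iota_forall m) //.
by apply: eq_forallb => j; rewrite (at_ext_min _ H) ltn_ord.
Qed.

Lemma all_ext_max s v p : reflects s v p -> all_ext true s (seen v) = (b ^ m %| p.+1).
Proof.
move=> H; rewrite dvdn_exp_lowS // (@all_iota_forall m) //.
by apply: eq_forallb => j; rewrite (at_ext_max _ H) ltn_ord.
Qed.

Lemma reflects_up s v p : reflects s v p ->
  reflects (cnt_dir true s (seen v))
    (fun i => move_input n (cnt_move true s (seen v) i) (v i)) p.+1.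
Proof.
move=> H i; split; first by apply: move_input_le; case: (H i).
rewrite !ffunE (carry_up _ H) (at_ext_max _ H) digS //.
case: (H i) => Hv; have Hd : dig b p i <= n.+1 by rewrite -ltnS; exact: dig_lt.
case: (b ^ i %| p.+1) => /=; last by rewrite addbF.
case: (dig b p i =P b.-1) => Hm /=; rewrite ?addbF ?addbT /eff /move_input -/n /b /= in Hm *;
  case: (s i) => /= He; lia.
Qed.

Lemma reflects_down s v p : reflects s v p.+1 ->
  reflects (cnt_dir false s (seen v))
    (fun i => move_input n (cnt_move false s (seen v) i) (v i)) p.
Proof.
move=> H i; split; first by apply: move_input_le; case: (H i).
rewrite !ffunE (carry_down _ H) (at_ext_min _ H).
case: (H i) => Hv He; move: He; rewrite digS //.
have Hd : dig b p i <= n.+1 by rewrite -ltnS; exact: dig_lt.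
case: (b ^ i %| p.+1) => /=; last by rewrite addbF.
case: (dig b p i =P b.-1) => Hm /=; rewrite ?addbF ?addbT /eff /move_input -/n /b /= in Hm *;
  case: (s i) => /= He; lia.
Qed.

(** Only [m] digits are stored, so a counter is known modulo [b ^ m] and wraps around without any
    special case. *)
Lemma reflects_mod s v p : reflects s v (p %% b ^ m) <-> reflects s v p.
Proof. by split=> H i; have := H i; rewrite dig_mod. Qed.
End Reflected.

(** * Automata with heads and counters *)

(** An intermediate programming model: next to its heads it has counters modulo a power of [n + 2],
    of which a transition sees only whether they are zero. Each counter is later compiled into [d]
    heads. *)
Record cmach (Sigma H C : finType) := CMach {
  cm_state : finType;
  cm_mem : finType;
  cm_trans : cm_state -> {ffun H -> endmarked Sigma} -> {ffun C -> bool} -> cm_mem ->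
             cm_state * {ffun H -> move} * {ffun C -> move} * option W15_mark;
  cm_init : cm_state;
  cm_acc : {set cm_state}
}.

Definition move_counter (N : nat) (m : move) (x : nat) : nat :=
  match m with MoveL => (x + N.-1) %% N | Stay => x | MoveR => x.+1 %% N end.

Lemma move_counter_pred N x : 0 < x < N -> move_counter N MoveL x = x.-1.
Proof.
move=> H /=; have -> : x + N.-1 = x.-1 + N by lia.
by rewrite modnDr modn_small; lia.
Qed.

(** All heads start at position 1, so a compiled counter starts with every digit equal to 1. This
    number is of the order of the modulus and serves as the initial budget of a counter. *)
Fixpoint repunit (b d : nat) : nat := if d is d'.+1 then repunit b d' * b + 1 else 0.

Lemma dig_repunit b d i : 1 < b -> i < d -> dig b (repunit b d) i = 1.
Proof.
move=> b1; elim: d i => // d IH [|i] Hi /=.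
  by rewrite /dig expn0 divn1 modnMDl modn_small.
have b0 : 0 < b by lia.
by rewrite /dig expnS divnMA divnMDl // (divn_small b1) addn0; apply: IH.
Qed.

Lemma repunit_lt b d : 1 < b -> repunit b d < b ^ d.
Proof. by move=> b1; elim: d => //= d IH; rewrite expnSr; nia. Qed.

Lemma repunit_ge b d : b ^ d <= repunit b d.+1.
Proof.
elim: d => // d IH; rewrite expnSr.
have -> : repunit b d.+2 = repunit b d.+1 * b + 1 by [].
by nia.
Qed.

Section CMachRun.
Variables (Sigma H C : finType) (d : nat) (A : cmach Sigma H C).

Record cm_conf := CmConf {
  cc_state : cm_state A;
  cc_heads : {ffun H -> nat};
  cc_cnt : {ffun C -> nat};
  cc_cell : nat
}.

Definition cm_conf0 (w : seq Sigma) : cm_conf :=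
  CmConf (cm_init A) [ffun=> 1] [ffun=> repunit (size w).+2 d] 0.

Definition cm_step (w : seq Sigma) (mu : nat -> cm_mem A) (c : cm_conf) : cm_conf :=
  let: (q, mh, mc, e) :=
    cm_trans (cc_state c) [ffun i => input_at w (cc_heads c i)]
             [ffun i => cc_cnt c i == 0] (mu (cc_cell c)) in
  CmConf q [ffun i => move_input (size w) (mh i) (cc_heads c i)]
         [ffun i => move_counter ((size w).+2 ^ d) (mc i) (cc_cnt c i)]
         (if e is Some m then W15_edge m (cc_cell c) else cc_cell c).

Definition cm_run w mu t := iter t (cm_step w mu) (cm_conf0 w).

Definition cm_accepts w :=
  exists mu : nat -> cm_mem A, exists t, cc_state (cm_run w mu t) \in cm_acc A.

Definition cm_index : finType := (H + C * 'I_d)%type.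

Definition cm_digits (y : cm_index -> endmarked Sigma) (c : C) : {ffun 'I_d -> endmarked Sigma} :=
  [ffun i => y (inr (c, i))].

Definition compile_trans (qs : cm_state A * {ffun C -> {ffun 'I_d -> bool}})
    (y : {ffun 'I_#|cm_index| -> endmarked Sigma}) (x : cm_mem A) :
    cm_state A * {ffun C -> {ffun 'I_d -> bool}} * {ffun 'I_#|cm_index| -> move}
    * option W15_mark :=
  let: (q, s) := qs in
  let y' k := y (enum_rank k) in
  let: (q', mh, mc, e) :=
    cm_trans q [ffun i => y' (inl i)] [ffun c => all_ext false (s c) (cm_digits y' c)] x in
  (q', [ffun c => match mc c with
                  | Stay => s c
                  | MoveR => cnt_dir true (s c) (cm_digits y' c)
                  | MoveL => cnt_dir false (s c) (cm_digits y' c)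
                  end],
   [ffun j => match enum_val j with
              | inl i => mh i
              | inr (c, i) => match mc c with
                              | Stay => Stay
                              | MoveR => cnt_move true (s c) (cm_digits y' c) i
                              | MoveL => cnt_move false (s c) (cm_digits y' c) i
                              end
              end], e).

Definition compile : mem_automaton Sigma #|cm_index| :=
  MemAutomaton compile_trans (cm_init A, [ffun=> [ffun=> false]])
    [set qs | qs.1 \in cm_acc A].

Definition represents (w : seq Sigma) (c : cm_conf) (a : ma_conf compile) : Prop :=
  let v k := mc_heads a (enum_rank k) in
  [/\ (mc_state a).1 = cc_state c, mc_cell a = cc_cell c,
      forall i, v (inl i) = cc_heads c i &
      forall x, cc_cnt c x < (size w).+2 ^ d /\
                reflects w ((mc_state a).2 x) (fun i => v (inr (x, i))) (cc_cnt c x)].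

Lemma represents0 w : represents w (cm_conf0 w) (ma_conf0 compile).
Proof.
split => //= [i|x]; first by rewrite !ffunE.
split; first by rewrite ffunE repunit_lt.
by move=> i; rewrite !ffunE /= dig_repunit.
Qed.

Lemma cm_digits_seen w (v : {ffun 'I_#|cm_index| -> nat}) c :
  cm_digits (fun k => [ffun j => input_at w (v j)] (enum_rank k)) c
  = seen w (fun i => v (enum_rank (inr (c, i)))).
Proof. by apply/ffunP => i; rewrite !ffunE. Qed.

Lemma represents_step w mu c a :
  represents w c a -> represents w (cm_step w mu c) (@ma_step _ _ compile w mu a).
Proof.
case: a => -[q s] v k; case: c => q0 hd cn k0 [/= -> -> Hh Hc] {q k}.
rewrite /cm_step /ma_step /=.
have -> : [ffun i => [ffun i0 => input_at w (v i0)] (enum_rank (inl i))]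
    = [ffun i => input_at w (hd i)].
  by apply/ffunP => i; rewrite !ffunE Hh.
have -> : [ffun c => all_ext false (s c) (cm_digits
             (fun k => [ffun i => input_at w (v i)] (enum_rank k)) c)]
    = [ffun i => cn i == 0].
  apply/ffunP => x; rewrite !ffunE cm_digits_seen; case: (Hc x) => Hlt Hr.
  rewrite (all_ext_zero Hr); apply/idP/eqP => [|->]; last exact: dvdn0.
  by case: (cn x) Hlt => // y Hlt /dvdn_leq; lia.
case: (cm_trans _ _ _ _) => [[[q' mh] mc] e] /=.
split => //= [i|x]; first by rewrite !ffunE enum_rankK Hh.
case: (Hc x) => Hlt Hr.
have HN : 0 < (size w).+2 ^ d by rewrite expn_gt0.
rewrite !ffunE; split.
  by rewrite /move_counter; case: (mc x) => //; rewrite ltn_mod.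
rewrite cm_digits_seen.
case E : (mc x) => /=.
- apply/reflects_mod; move=> i; rewrite ffunE ffunE enum_rankK E cm_digits_seen.
  (* A decrement may start from zero. Adding the modulus keeps the stored digits and gives the
     successor that [reflects_down] asks for. *)
  suff /reflects_down /(_ i) : reflects w (s x) (fun i => v (enum_rank (inr (x, i))))
    (cn x + ((size w).+2 ^ d).-1).+1 by [].
  rewrite -addnS prednK //; apply/reflects_mod; rewrite modnDr; exact/reflects_mod.
- by move=> i; rewrite ffunE ffunE enum_rankK E; exact: (Hr i).
- apply/reflects_mod; move=> i; rewrite ffunE ffunE enum_rankK E cm_digits_seen.
  exact: (reflects_up Hr i).
Qed.

Lemma represents_run w mu t : represents w (cm_run w mu t) (@ma_run _ _ compile w mu t).
Proof.
elim: t => [|t IH]; first exact: represents0.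
by rewrite /cm_run /ma_run !iterS; exact: represents_step.
Qed.

Lemma compile_cell w mu t : mc_cell (@ma_run _ _ compile w mu t) = cc_cell (cm_run w mu t).
Proof. by case: (represents_run w mu t). Qed.

Lemma compile_accepts w : ma_accepts compile w <-> cm_accepts w.
Proof.
split=> -[mu [t Ht]]; exists mu, t; move: Ht;
  by case: (represents_run w mu t); rewrite inE => ->.
Qed.
End CMachRun.

(** * Verifying a space-bounded computation cell by cell *)

Section Verifier.
Variables (Sigma : finType) (k : nat) (M : turing_machine Sigma k).
Let Q := tm_state M.
Let G := tm_sym M.

(* None counts the passes left, Some (j, false) is the position of work head j
   and Some (j, true) that position minus the cell tracked in this pass. *)
Definition ver_cnt : finType := option ('I_k * bool)%type.
(* inr None rewinds; inr (Some true) accepts and inr (Some false) rejects. *)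
Definition ver_state : finType := (Q * {ffun 'I_k -> G} + option bool)%type.
Definition ver_mem : finType := {ffun 'I_k -> G}.

(** Counters wrap below zero, whereas a work head stays on cell 0; the zero test makes up for the
    difference. *)
Definition stop_left (m : move) (z : bool) : move :=
  if m is MoveL then (if z then Stay else MoveL) else m.

(** The tracked cell [y] is stored only as the difference of the two counters of a head. Simulated
    moves and rewinding change both alike, so [y] survives them; at the end of a pass the relative
    counters alone are lowered, which replaces [y] by [y + 1]. The component [tr] holds the contents
    of cell [y] on all tapes. *)
Definition ver_trans (st : ver_state) (y : {ffun unit -> endmarked Sigma})
    (z : {ffun ver_cnt -> bool}) (x : ver_mem) :
    ver_state * {ffun unit -> move} * {ffun ver_cnt -> move} * option W15_mark :=
  match st with
  | inr (Some _) => (st, [ffun=> Stay], [ffun=> Stay], None)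
  | inr None =>
      if (y tt == LEnd) && [forall j, z (Some (j, false))] then
        if z None then (inr (Some true), [ffun=> Stay], [ffun=> Stay], None)
        else (inl (tm_init M, [ffun=> tm_blank M]), [ffun=> MoveR],
              [ffun c => if c is None then MoveL else Stay], Some MarkMinus)
      else
        (inr None, [ffun=> MoveL],
         [ffun c => if c is Some (j, _) then stop_left MoveL (z (Some (j, false))) else Stay],
         Some MarkMinus)
  | inl (q, tr) =>
      if q == tm_accept M then
        (inr None, [ffun=> Stay], [ffun c => if c is Some (_, true) then MoveL else Stay],
         Some MarkMinus)
      else if (q == tm_reject M) || ~~ [forall j, z (Some (j, true)) ==> (x j == tr j)] then
        (inr (Some false), [ffun=> Stay], [ffun=> Stay], None)
      else
        let: (q', m, act) := tm_trans q (y tt) x in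
        (inl (q', [ffun j => if z (Some (j, true)) then (act j).1 else tr j]), [ffun=> m],
         [ffun c => if c is Some (j, _) then stop_left (act j).2 (z (Some (j, false))) else Stay],
         Some MarkPlus)
  end.

Definition verifier : cmach Sigma unit ver_cnt :=
  @CMach Sigma unit ver_cnt ver_state ver_mem ver_trans (inr None) [set inr (Some true)].

Section Input.
Variables (w : seq Sigma) (d : nat) (mu : nat -> ver_mem).
Let n := size w.
Let N := n.+2 ^ d.
Let B := repunit n.+2 d.
Let crun := @cm_run _ _ _ d verifier w mu.

Lemma BN : B < N.
Proof. exact: repunit_lt. Qed.

(* The run of M in which the scanned symbols are read off mu. *)
Definition vhalted (q : Q) := (q == tm_accept M) || (q == tm_reject M).
Definition vmove (m : move) (x : nat) := move_counter N (stop_left m (x == 0)) x.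
Fixpoint vrun (t : nat) : Q * nat * {ffun 'I_k -> nat} :=
  if t is t'.+1 then
    let: (q, i, v) := vrun t' in
    if vhalted q then vrun t' else
    let: (q', m, act) := tm_trans q (input_at w i) (mu t') in
    (q', move_input n m i, [ffun j => vmove (act j).2 (v j)])
  else (tm_init M, 1, [ffun=> 0]).
Fixpoint vcell (y : nat) (t : nat) : {ffun 'I_k -> G} :=
  if t is t'.+1 then
    let: (q, i, v) := vrun t' in
    if vhalted q then vcell y t' else
    let: (q', m, act) := tm_trans q (input_at w i) (mu t') in
    [ffun j => if v j == y then (act j).1 else vcell y t' j]
  else [ffun=> tm_blank M].

Definition vcheck (y t : nat) : bool :=
  ~~ vhalted (vrun t).1.1 && [forall j, ((vrun t).2 j == y) ==> (mu t j == vcell y t j)].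

Definition shift (y x : nat) : nat := (x + (N - y)) %% N.

Lemma shift_move y m x : shift y (move_counter N m x) = move_counter N m (shift y x).
Proof.
rewrite /shift; case: m => //=; first by rewrite !modnDml addnAC.
by rewrite modnDml addSn -addn1 -[in RHS]addn1 modnDml.
Qed.

Lemma shift_eq0 y x : y < N -> x < N -> (shift y x == 0) = (x == y).
Proof.
move=> Hy Hx; rewrite /shift; case: (ltnP x y) => Hxy.
  by rewrite modn_small; lia.
have -> : x + (N - y) = (x - y) + N by lia.
by rewrite modnDr modn_small; lia.
Qed.

Lemma shift_pred y x : y.+1 < N -> move_counter N MoveL (shift y x) = shift y.+1 x.
Proof.
move=> Hy; rewrite /shift /= modnDml.
have -> : x + (N - y) + N.-1 = x + (N - y.+1) + N by lia.
by rewrite modnDr.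
Qed.

Definition cnts (I : nat) (v : {ffun 'I_k -> nat}) (y : nat) : {ffun ver_cnt -> nat} :=
  [ffun c => match c with
             | None => I
             | Some (j, false) => v j
             | Some (j, true) => shift y (v j)
             end].

Definition rewind_conf (y i : nat) (v : {ffun 'I_k -> nat}) (c : nat) : cm_conf verifier :=
  @CmConf _ _ _ verifier (inr None) [ffun=> i] (cnts (B - y) v y) c.
Definition pass_conf (y t : nat) : cm_conf verifier :=
  @CmConf _ _ _ verifier (inl ((vrun t).1.1, vcell y t)) [ffun=> (vrun t).1.2]
    (cnts (B - y.+1) (vrun t).2 y) t.

Lemma move_counter_lt m x : x < N -> move_counter N m x < N.
Proof. by move=> Hx; case: m => //=; rewrite ltn_mod; lia. Qed.

Lemma vrun_lt t j : (vrun t).2 j < N.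
Proof.
elim: t => [|t IH] /=; first by rewrite ffunE expn_gt0.
move: IH; case: (vrun t) => [[q i] v] /= IH; case: ifP => // _.
case: (tm_trans _ _ _) => [[q' m] act] /=; rewrite ffunE.
exact: move_counter_lt.
Qed.

Definition cstep := @cm_step _ _ _ d verifier w mu.

Lemma step_rewind y (i : nat) (v : {ffun 'I_k -> nat}) c : (forall j, v j < N) -> ~~ ((i == 0) && [forall j, v j == 0]) ->
  cstep (rewind_conf y i v c) = rewind_conf y i.-1 [ffun j => (v j).-1] 0.
Proof.
move=> Hv Hn; rewrite /cstep /cm_step /= !ffunE input_at_LEnd.
rewrite (_ : [forall j, _] = [forall j, v j == 0]); last by apply: eq_forallb => j; rewrite !ffunE.
rewrite (negbTE Hn); congr CmConf; apply/ffunP => x; rewrite !ffunE //=.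
case: x => [[j e]|] //; rewrite !ffunE.
have E : move_counter N (stop_left MoveL (v j == 0)) (v j) = (v j).-1.
  case: eqP => [->//|Hj]; apply: move_counter_pred; rewrite Hv andbT; lia.
by case: e => //; rewrite -shift_move E.
Qed.

Lemma step_start y (v : {ffun 'I_k -> nat}) c : y < B -> (forall j, v j = 0) ->
  cstep (rewind_conf y 0 v c) = pass_conf y 0.
Proof.
move=> Hy Hv; have HBN := BN; rewrite /cstep /cm_step /= !ffunE input_at_LEnd /=.
rewrite (_ : [forall j, _]); last by apply/forallP => j; rewrite !ffunE Hv.
rewrite (_ : (B - y == 0) = false) /=; last by lia.
congr CmConf; apply/ffunP => x; rewrite !ffunE //=; first by rewrite minnE; lia.
case: x => [[j []]|]; rewrite ?ffunE ?Hv //.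
by rewrite move_counter_pred ?subnS // subn_gt0 Hy; exact: leq_ltn_trans (leq_subr _ _) HBN.
Qed.

Lemma step_done (v : {ffun 'I_k -> nat}) c : (forall j, v j = 0) ->
  cc_state (cstep (rewind_conf B 0 v c)) = inr (Some true).
Proof.
move=> Hv; rewrite /cstep /cm_step /= !ffunE input_at_LEnd /=.
rewrite (_ : [forall j, _]); last by apply/forallP => j; rewrite !ffunE Hv.
by rewrite subnn.
Qed.

Lemma step_pass_end y t : y < B -> (vrun t).1.1 = tm_accept M ->
  cstep (pass_conf y t) = rewind_conf y.+1 (vrun t).1.2 (vrun t).2 0.
Proof.
move=> Hy Hq; have HBN := BN; rewrite /cstep /cm_step /= Hq eqxx.
congr CmConf; apply/ffunP => x; rewrite !ffunE //=.
case: x => [[j []]|] //; apply: shift_pred; lia.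
Qed.

Lemma forall_shift y t (P : pred 'I_k) : y < N ->
  [forall j, ([ffun c => cnts (B - y.+1) (vrun t).2 y c == 0] (Some (j, true))) ==> P j]
  = [forall j, ((vrun t).2 j == y) ==> P j].
Proof. by move=> Hy; apply: eq_forallb => j; rewrite !ffunE shift_eq0 // vrun_lt. Qed.

Lemma step_pass y t : y < N -> vcheck y t -> cstep (pass_conf y t) = pass_conf y t.+1.
Proof.
move=> Hy; rewrite /vcheck /vhalted negb_or => /andP [/andP [Ha Hr] Hc].
rewrite /cstep /cm_step /= (negbTE Ha) (negbTE Hr) forall_shift // Hc /= ffunE ffunE.
have Hlt := vrun_lt t; rewrite /pass_conf /= /vhalted.
case: (vrun t) Ha Hr Hlt => [[q i] v] /= /negbTE -> /negbTE -> Hlt /=.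
case: (tm_trans _ _ _) => [[q' m] act] /=; congr CmConf.
- by congr (inl (_, _)); apply/ffunP => j; rewrite !ffunE shift_eq0.
- by apply/ffunP => x; rewrite !ffunE.
- apply/ffunP => x; rewrite !ffunE; case: x => [[j e]|] //; rewrite !ffunE.
  by case: e => //; rewrite -shift_move.
Qed.

Lemma step_pass_fail y t : y < N -> (vrun t).1.1 != tm_accept M -> ~~ vcheck y t ->
  cc_state (cstep (pass_conf y t)) = inr (Some false).
Proof.
move=> Hy Ha Hc; rewrite /cstep /cm_step /= (negbTE Ha) forall_shift //.
rewrite ifT //; move: Hc; rewrite /vcheck /vhalted (negbTE Ha) /= negb_and negbK.
by [].
Qed.

Lemma crun0 : crun 0 = rewind_conf 0 1 [ffun=> B] 0.
Proof.
congr CmConf; apply/ffunP => x; rewrite !ffunE subn0; case: x => [[j []]|] //; rewrite ?ffunE //.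
by rewrite /shift subn0 modnDr modn_small // BN.
Qed.

Definition pass_ok (y : nat) := exists2 T, (vrun T).1.1 = tm_accept M & forall t, t < T -> vcheck y t.

(** The four phases: rewinding before pass [y], step [t] of pass [y], failure, success. In each but
    failure, all completed passes are known to be correct. *)
Definition ver_inv (c : cm_conf verifier) : Prop :=
  [\/ exists y i (v : {ffun 'I_k -> nat}) z, [/\ c = rewind_conf y i v z, y <= B, forall j, v j < N
        & forall y', y' < y -> pass_ok y'],
      exists y t, [/\ c = pass_conf y t, y < B, forall s, s < t -> vcheck y s
        & forall y', y' < y -> pass_ok y'],
      cc_state c = inr (Some false) |
      cc_state c = inr (Some true) /\ forall y, y < B -> pass_ok y].

Lemma ver_inv_run t : ver_inv (crun t).
Proof.
have HBN := BN.
elim: t => [|t IH].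
  rewrite crun0; apply: Or41; exists 0, 1, [ffun=> B], 0; split=> // j; by rewrite ffunE.
rewrite [crun t.+1](_ : _ = cstep (crun t)) //.
case: IH => [[y [i [v [z [-> Hy Hv Hp]]]]]|[y [s [-> Hy Hs Hp]]]|E|[E Hp]].
- case: (boolP ((i == 0) && [forall j, v j == 0])) => [/andP [/eqP -> /forallP Hz]|Hn].
    have Hv0 j : v j = 0 by apply/eqP.
    move: Hy; rewrite leq_eqVlt => /orP [/eqP Ey|Hy].
      by apply: Or44; rewrite {1}Ey step_done // -Ey.
    rewrite step_start //; apply: Or42; exists y, 0; split=> //.
  rewrite step_rewind //; apply: Or41; exists y, i.-1, [ffun j => (v j).-1], 0; split=> // j.
  by rewrite ffunE; apply: leq_ltn_trans (leq_pred _) (Hv j).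
- case: (eqVneq (vrun s).1.1 (tm_accept M)) => [Ea|Ha].
    rewrite step_pass_end //; apply: Or41; eexists; eexists; eexists; eexists; split; [by []|by []|exact: vrun_lt|].
    move=> y'; rewrite ltnS leq_eqVlt => /orP [/eqP ->|]; last exact: Hp.
    by exists s.
  have HyN : y < N by lia.
  case: (boolP (vcheck y s)) => Hc; last by apply: Or43; exact: step_pass_fail.
  rewrite step_pass //; apply: Or42; exists y, s.+1; split=> // s'.
  by rewrite ltnS leq_eqVlt => /orP [/eqP ->|/Hs].
- by apply: Or43; rewrite /cstep /cm_step E.
- by apply: Or44; rewrite /cstep /cm_step E.
Qed.

Lemma reach_rewound y i (v : {ffun 'I_k -> nat}) z t : (forall j, v j < N) -> crun t = rewind_conf y i v z ->
  exists t' (v' : {ffun 'I_k -> nat}) z', (forall j, v' j = 0) /\ crun t' = rewind_conf y 0 v' z'.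
Proof.
move=> Hv; have [m Hm] : exists m, i <= m /\ forall j, v j <= m.
  by exists (N + i); split=> [|j]; [|have := Hv j]; lia.
elim: m i v z t Hv Hm => [|m IH] i v z t Hv [Hi Hj] E.
  exists t, v, z; split=> [j|]; first by apply/eqP; rewrite -leqn0.
  by rewrite E; move: Hi; rewrite leqn0 => /eqP ->.
case: (boolP ((i == 0) && [forall j, v j == 0])) => [/andP [/eqP Ei /forallP Hz]|Hn].
  exists t, v, z; split=> [j|]; first by apply/eqP.
  by rewrite E Ei.
apply: (IH i.-1 [ffun j => (v j).-1] 0 t.+1).
- by move=> j; rewrite ffunE; apply: leq_ltn_trans (leq_pred _) (Hv j).
- by split=> [|j]; rewrite ?ffunE; [|have := Hj j]; lia.
- by rewrite [crun t.+1](_ : _ = cstep (crun t)) // E step_rewind.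
Qed.

Lemma pass_ok_accepts : (forall y, y < B -> pass_ok y) -> exists t, cc_state (crun t) = inr (Some true).
Proof.
move=> Hp; have HBN := BN.
have key y : y <= B -> exists i (v : {ffun 'I_k -> nat}) z t, (forall j, v j < N) /\ crun t = rewind_conf y i v z.
  elim: y => [|y IH] Hy.
    by exists 1, [ffun=> B], 0, 0; split; [move=> j; rewrite ffunE|exact: crun0].
  have [i [v [z [t [Hv E]]]]] := IH (ltnW Hy).
  have [t1 [v1 [z1 [Hv1 E1]]]] := reach_rewound Hv E.
  have [T HT HC] := Hp y Hy.
  have Hr s : s <= T -> crun (t1.+1 + s) = pass_conf y s.
    elim: s => [|s IHs] Hs.
      by rewrite addn0 [crun t1.+1](_ : _ = cstep (crun t1)) // E1 step_start.
    rewrite addnS [crun _.+1](_ : _ = cstep (crun (t1.+1 + s))) // IHs ?(ltnW Hs) //.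
    by apply: step_pass; [lia|exact: HC].
  exists (vrun T).1.2, (vrun T).2, 0, (t1.+1 + T).+1; split; first exact: vrun_lt.
  by rewrite [crun _.+1](_ : _ = cstep (crun (t1.+1 + T))) // Hr // step_pass_end.
have [i [v [z [t [Hv E]]]]] := key B (leqnn B).
have [t1 [v1 [z1 [Hv1 E1]]]] := reach_rewound Hv E.
exists t1.+1; by rewrite [crun t1.+1](_ : _ = cstep (crun t1)) // E1 step_done.
Qed.

Hypothesis space : forall t j, tc_heads (tm_run M w t) j < B.

Definition scanned (t : nat) : ver_mem := [ffun j => tc_tapes (tm_run M w t) j (tc_heads (tm_run M w t) j)].

(** As long as the memory has told the truth, the replayed run is the real one: the space bound
    keeps the counters from wrapping, and both runs freeze once they halt. *)
Lemma vrun_real t : (forall s, s < t -> mu s = scanned s) ->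
  vrun t = (tc_state (tm_run M w t), tc_input (tm_run M w t), tc_heads (tm_run M w t)) /\
  forall y j, vcell y t j = tc_tapes (tm_run M w t) j y.
Proof.
elim: t => [|t IH] Hmu; first by split=> // y j; rewrite ffunE.
have [|Ev Ec] := IH; first by move=> s Hs; apply: Hmu; exact: ltnW.
have := space t.+1; have Hsp := space t.
rewrite [tm_run M w t.+1](_ : _ = tm_step w (tm_run M w t)) //= Ev.
rewrite Hmu // /vhalted /tm_step /tm_halted /scanned.
case: ifP => Hh; first by move=> _; split.
case: (tm_trans _ _ _) => [[q' m] act] /= Hsp'; split.
  congr (_, _); apply/ffunP => j; rewrite !ffunE.
  have := Hsp' j; have := Hsp j; rewrite ffunE /vmove; have := BN.
  case: ((act j).2) => //= H1 H2 H3; last by rewrite modn_small //; lia.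
  case: eqP => [->//|H0]; apply: move_counter_pred; lia.
by move=> y j; rewrite ffunE Ec eq_sym.
Qed.

(** A single pass vouches for one cell only. At step [t], however, each head scans some cell below
    [B], and the pass for that cell checks the symbol claimed at step [t]. By induction on [t] all
    claims are true. *)
Lemma pass_ok_real : 0 < B -> (forall y, y < B -> pass_ok y) -> tm_accepts M w.
Proof.
move=> B0 Hp; have [T HT HC0] := Hp 0 B0.
(* The passes share one run of states, so none can accept before time [T]: the pass for cell 0 found
   the state unhalted at every earlier time. *)
have HC y t : y < B -> t < T -> vcheck y t.
  move=> Hy Ht; have [T' HT' HC'] := Hp y Hy; apply: HC'.
  apply: leq_trans Ht _; rewrite leqNgt; apply/negP => /HC0.
  by rewrite /vcheck /vhalted HT' eqxx.
suff Hmu t : t <= T -> forall s, s < t -> mu s = scanned s.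
  by exists T; have [E _] := vrun_real (Hmu T (leqnn T)); rewrite E in HT.
elim: t => // t IH Ht s; rewrite ltnS leq_eqVlt => /orP [/eqP ->|]; last by apply: IH; exact: ltnW.
have [Ev Ec] := vrun_real (IH (ltnW Ht)).
apply/ffunP => j; rewrite ffunE -Ec.
have /andP [_ /forallP /(_ j)] := HC _ t (space t j) Ht.
by rewrite Ev /= eqxx => /eqP.
Qed.
End Input.

Lemma real_pass_ok w d : (forall t j, tc_heads (tm_run M w t) j < repunit (size w).+2 d) ->
  tm_accepts M w -> forall y, pass_ok w d (scanned w) y.
Proof.
move=> Hsp [t0 Ht0] y.
have Hr t : vrun w d (scanned w) t =
    (tc_state (tm_run M w t), tc_input (tm_run M w t), tc_heads (tm_run M w t)).
  by have [-> _] := @vrun_real w d (scanned w) Hsp t (fun _ _ => erefl).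
have Hc t j : vcell w d (scanned w) y t j = tc_tapes (tm_run M w t) j y.
  by have [_ ->] := @vrun_real w d (scanned w) Hsp t (fun _ _ => erefl).
have Hex : exists t, tm_halted (tm_run M w t) by exists t0; rewrite /tm_halted Ht0 eqxx.
(* The first halting time: no earlier state is halted, as [vcheck] demands, and the configuration is
   constant from then on, so it is the accepting one. *)
case: (ex_minnP Hex) => T HT Hmin.
have HTt : T <= t0 by apply: Hmin; rewrite /tm_halted Ht0 eqxx.
have Hst s : tm_run M w (s + T) = tm_run M w T.
  by elim: s => // s IH; rewrite addSn /tm_run iterS -/(tm_run M w (s + T)) IH /tm_step HT.
exists T; first by rewrite Hr /= -(Hst (t0 - T)) subnK.
move=> t Ht; apply/andP; split.
  rewrite Hr; apply/negP => H; have : T <= t by exact: Hmin.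
  by lia.
by apply/forallP => j; apply/implyP; rewrite Hr /= => /eqP Ey; rewrite Hc ffunE Ey.
Qed.

Lemma verifier_accepts w d : 0 < d ->
  (forall t j, tc_heads (tm_run M w t) j < repunit (size w).+2 d) ->
  cm_accepts d verifier w <-> tm_accepts M w.
Proof.
case: d => // d _ Hsp; split=> [[mu [t]]|Ha].
  rewrite inE => /eqP Et; apply: (pass_ok_real (mu := mu) Hsp); first by rewrite /= addn1.
  have := @ver_inv_run w d.+1 mu t; case=> [[y [i [v [z [E _ _ _]]]]]|[y [s [E _ _ _]]]|E|[_ //]];
    by rewrite E in Et.
exists (scanned w).
have [t Et] := @pass_ok_accepts w d.+1 (scanned w) (fun y _ => real_pass_ok Hsp Ha y).
by exists t; rewrite inE Et.
Qed.
End Verifier.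

(** * Polynomial bounds, and PSPACE inside the class of W_1.5 *)

Lemma horner_le_power (p : {poly nat}) : exists d, forall n, (p.[n])%R <= n.+2 ^ d.
Proof.
elim/poly_ind: p => [|p c [d IH]]; first by exists 0 => n; rewrite horner0.
exists (d + c).+1 => n; rewrite hornerMXaddC natrDE natrME.
have H1 := IH n; have H2 : c < n.+2 ^ c by exact: ltn_expl.
have H3 : 0 < n.+2 ^ d by rewrite expn_gt0.
rewrite expnS expnD; move: H1 H2 H3; move: (p.[n])%R (n.+2 ^ d) (n.+2 ^ c) => a u v H1 H2 H3.
have H4 : a * n <= u * v * n by rewrite leq_mul2r; apply/orP; right; nia.
have H5 : v <= u * v by nia.
by rewrite !mulSn [n * _]mulnC; lia.
Qed.

Lemma PSPACE_R_W15 (Sigma : finType) (L : language Sigma) : PSPACE L -> R_W15 L.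
Proof.
case=> p [k [M [HM Hsp]]]; have [d Hd] := horner_le_power p.
(* One digit more than the bound needs: by [repunit_ge] the initial counter value with [d + 1]
   digits is at least [(n + 2) ^ d]. *)
exists #|cm_index unit (ver_cnt k) d.+1|; split.
  by apply/card_gt0P; exists (inl tt).
exists (compile d.+1 (verifier M)) => w; have [_ ->] := HM w.
rewrite compile_accepts verifier_accepts // => t j.
apply: leq_trans (Hsp w t j) (leq_trans (Hd _) _); exact: repunit_ge.
Qed.

Lemma ma_runS (Sigma : finType) (h : nat) (A : mem_automaton Sigma h) w
  (mu : nat -> ma_mem A) t : ma_run w mu t.+1 = ma_step w mu (ma_run w mu t).
Proof. by []. Qed.

(** * Halving a path *)

Section Halving.
Variables (T : finType) (e : rel T).

Fixpoint reach2 (k : nat) (a b : T) : bool :=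
  if k is k'.+1 then [exists m, reach2 k' a m && reach2 k' m b] else e a b.

Lemma reach2_connect k a b : reach2 k a b -> connect e a b.
Proof.
elim: k a b => [|k IH] a b /=; first exact: connect1.
by case/existsP => m /andP [/IH H1 /IH H2]; exact: connect_trans H1 H2.
Qed.

(** Used to obtain a memory symbol where only the existence of one matters. *)
Lemma reach2_edge k a b : reach2 k a b -> exists c d, e c d.
Proof.
elim: k a b => [|k IH] a b /=; first by exists a, b.
by case/existsP => m /andP [/IH].
Qed.

Lemma path_reach2 k a p : path e a p -> size p = 2 ^ k -> reach2 k a (last a p).
Proof.
elim: k a p => [|k IH] a p /=.
  by case: p => [|x [|y p]] //=; rewrite andbT.
move=> Hp Hs; apply/existsP; exists (last a (take (2 ^ k) p)).
move: Hp; rewrite -{1 4}(cat_take_drop (2 ^ k) p) cat_path last_cat => /andP [H1 H2].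
have H2k : 2 ^ k.+1 = 2 ^ k + 2 ^ k by rewrite expnS; lia.
by rewrite !IH // ?size_drop ?size_takel; lia.
Qed.

(** A simple path has fewer than [#|T|] edges, and the loop at the target pads it to exactly [2 ^ k]
    of them. *)
Lemma connect_reach2 k a b : e b b -> #|T| <= 2 ^ k -> connect e a b -> reach2 k a b.
Proof.
move=> Hb Hk /connectP [p Hp Eb]; rewrite {b}Eb in Hb *.
case/shortenP: Hp Hb => p' Hp' Hu _ Hb.
have Hs : size p' < #|T| by have := max_card (mem (a :: p')); rewrite (card_uniqP Hu).
have -> : last a p' = last a (p' ++ nseq (2 ^ k - size p') (last a p')).
  rewrite last_cat; elim: (2 ^ k - size p') (last a p') => //= m IH x; exact: IH.
apply: path_reach2; last by rewrite size_cat size_nseq subnKC //; apply: leq_trans Hk; exact: ltnW.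
rewrite cat_path Hp' /=; elim: (_ - _) => //= m ->; by rewrite Hb.
Qed.
End Halving.

(** * Acceptance as reachability between labellings of the grid of head positions *)

Section Chain.
Variables (Sigma : finType) (h : nat) (A : mem_automaton Sigma h) (w : seq Sigma).
Let n := size w.
Let Q := ma_state A.

Definition grid : finType := {ffun 'I_h -> 'I_n.+2}.
Definition node : finType := {ffun grid -> {set Q}}.
Definition node0 : node := [ffun=> set0].
Definition grid1 : grid := [ffun=> inord 1].
Definition gsyms (g : grid) : {ffun 'I_h -> endmarked Sigma} := [ffun i => input_at w (g i)].
Definition gmove (ms : {ffun 'I_h -> move}) (g : grid) : grid :=
  [ffun i => inord (move_input n (ms i) (g i))].

(* S labels memory cell 0 and b the cell after the current one. *)
Definition good_move (S b : node) (g : grid) (x : ma_mem A) (q : Q) : bool :=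
  (q \in ma_acc A) ||
  let: (q', ms, e) := ma_trans q (gsyms g) x in
  match e with
  | Some MarkPlus => q' \in b (gmove ms g)
  | Some MarkMinus => q' \in S (gmove ms g)
  | None => false
  end.

Definition edge (S a b : node) : bool :=
  [exists x, forall g, forall q, (q \in a g) ==> good_move S b g x q].

Definition stay_free := forall q y x, (@ma_trans _ _ A q y x).2 != None.

(* r bounds the number of memory resets still to come. *)
Definition clocked := forall mu : nat -> ma_mem A, exists r : nat -> nat, forall t,
  let c := mc_cell (ma_run w mu t) in
  let c' := mc_cell (ma_run w mu t.+1) in
  (c' = c.+1 /\ r t.+1 <= r t) \/ (c' = 0 /\ r t.+1 < r t).

Definition ghead (g : grid) : {ffun 'I_h -> nat} := [ffun i => g i : nat].
Definition to_grid (v : {ffun 'I_h -> nat}) : grid := [ffun i => inord (v i)].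

Lemma ghead_move ms g : ghead (gmove ms g) = [ffun i => move_input n (ms i) (ghead g i)].
Proof.
apply/ffunP => i; rewrite !ffunE inordK // ltnS; apply: move_input_le.
by rewrite -ltnS.
Qed.

Lemma ghead1 : ghead grid1 = [ffun=> 1].
Proof. by apply/ffunP => i; rewrite !ffunE inordK. Qed.

Lemma gsymsE g : [ffun i => input_at w (ghead g i)] = gsyms g.
Proof. by apply/ffunP => i; rewrite !ffunE. Qed.

Lemma run_ghead (mu : nat -> ma_mem A) t : exists g, mc_heads (ma_run w mu t) = ghead g.
Proof.
elim: t => [|t [g IH]]; first by exists grid1; rewrite ghead1.
rewrite /ma_run iterS -/(ma_run w mu t) /ma_step.
case: (ma_trans _ _ _) => [[q ms] e] /=.
by exists (gmove ms g); rewrite ghead_move IH.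
Qed.

(** Cell [c] is labelled by the pairs of state and head positions with which the run visits it up to
    time [T]. Cell [T + 1] is out of reach by then, so its label is empty and ends the chain. *)
Lemma accepts_connect : stay_free -> ma_accepts A w ->
  exists S : node, ma_init A \in S grid1 /\ connect (edge S) S node0.
Proof.
move=> Hs [mu [T HT]].
pose a c : node := [ffun g => [set q | [exists t : 'I_T.+1,
  [&& mc_state (ma_run w mu t) == q, mc_heads (ma_run w mu t) == ghead g
    & mc_cell (ma_run w mu t) == c]]]].
have aP c g q : reflect (exists t, [/\ t <= T, mc_state (ma_run w mu t) = q,
     mc_heads (ma_run w mu t) = ghead g & mc_cell (ma_run w mu t) = c]) (q \in a c g).
  rewrite ffunE inE; apply: (iffP existsP) => [[t /and3P [/eqP E1 /eqP E2 /eqP E3]]|[t [Ht <- Eh <-]]].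
    by exists t; split=> //; rewrite -ltnS.
  by exists (Ordinal (Ht : t < T.+1)); rewrite /= Eh !eqxx.
have Hcell t : mc_cell (ma_run w mu t) <= t.
  elim: t => // t IH; rewrite /ma_run iterS -/(ma_run w mu t) /ma_step.
  by case: (ma_trans _ _ _) => [[q ms] [[]|]] /=; lia.
have HE : a T.+1 = node0.
  apply/ffunP => g; apply/setP => q; rewrite [in RHS]ffunE inE; apply/negbTE/aP => -[t [Ht _ _ E]].
  by have := Hcell t; rewrite E; lia.
exists (a 0); split.
  by apply/aP; exists 0; split=> //=; rewrite ghead1.
rewrite -HE; elim: T.+1 => [|c IH]; first exact: connect0.
apply: connect_trans IH (connect1 _).
apply/existsP; exists (mu c); apply/forallP => g; apply/forallP => q; apply/implyP => /aP [t [Ht Eq Eg Ec]].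
rewrite /good_move; case: (boolP (q \in ma_acc A)) => //= Hq.
(* The state at time [T] accepts and needs no successor, so every step to be checked stays within
   the time window. *)
have HtT : t < T.
  rewrite ltn_neqAle Ht andbT; apply: contra Hq => /eqP E; by rewrite -Eq E.
have : ma_run w mu t.+1 = ma_step w mu (ma_run w mu t) by [].
rewrite /ma_step Eq Eg Ec gsymsE.
have := Hs q (gsyms g) (mu c).
case: (ma_trans _ _ _) => [[q' ms] [[]|]] //= _; rewrite -ghead_move => E;
  by apply/aP; exists t.+1; rewrite ma_runS E.
Qed.

(** The chain yields memory symbols for which the run stays inside the labels until it accepts. It
    can never enter the last, empty label, and it cannot go on for ever: with [L] the length of the
    chain, [r t * L.+1 + (L - cell)] drops at every step, forward or reset. *)
Lemma connect_accepts (S : node) : clocked ->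
  ma_init A \in S grid1 -> connect (edge S) S node0 -> ma_accepts A w.
Proof.
move=> Hc HS /connectP [p Hp Hl].
(* A symbol for the cells beyond the chain. The chain has an edge, for [S] contains the initial pair
   and so differs from [node0]. *)
have [x0 _] : exists x0 : ma_mem A, True.
  case: p Hp Hl => [_ /= E|b p /= /andP [/existsP [x _] _]]; last by exists x.
  by move: HS; rewrite -E ffunE inE.
pose a c := nth S (S :: p) c.
pose good c x := [forall g, forall q, (q \in a c g) ==> good_move S (a c.+1) g x q].
pose mu c := odflt x0 [pick x | good c x].
have Hmu c : c < size p -> good c (mu c).
  move=> Hcp; rewrite /mu; case: pickP => //= H0; exfalso.
  have /existsP [x Hx] : edge S (a c) (a c.+1) by move/pathP: Hp => /(_ S c Hcp).
  by have := H0 x; rewrite /good Hx.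
have [r Hr] := Hc mu.
pose L := size p.
have Ha : a L = node0.
  by rewrite Hl (last_nth S).
exists mu.
have key t : (exists s, mc_state (ma_run w mu s) \in ma_acc A) \/
  exists2 g, mc_heads (ma_run w mu t) = ghead g &
    [/\ mc_cell (ma_run w mu t) < L, mc_state (ma_run w mu t) \in a (mc_cell (ma_run w mu t)) g &
     r t * L.+1 + (L - mc_cell (ma_run w mu t)) + t <= r 0 * L.+1 + L].
  have notL c g q : c <= L -> q \in a c g -> c < L.
    rewrite leq_eqVlt => /orP [/eqP E|//]; by rewrite E Ha ffunE inE.
  elim: t => [|t [IH|[g Eg [Hlt Hin Hm]]]]; [|by left|].
    right; exists grid1; rewrite ?ghead1 //=; split=> //; last by rewrite addn0 leq_add2l leq_subr.
    exact: (notL 0 grid1 (ma_init A)).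
  have /forallP /(_ g) /forallP /(_ (mc_state (ma_run w mu t))) /implyP /(_ Hin) := Hmu _ Hlt.
  rewrite /good_move; case/orP => [H|H]; first by left; exists t.
  right.
  have Er : ma_run w mu t.+1 = ma_step w mu (ma_run w mu t) by [].
  move: H (Hr t); rewrite Er /ma_step Eg gsymsE.
  case: (ma_trans _ _ _) => [[q' ms] [[]|]] //= Hq [[E H]|[E H]] //; exists (gmove ms g);
    rewrite ?ghead_move //; split=> //; try exact: notL Hq; rewrite ?subn0; nia.
have [//|[g _ [_ _ H]]] := key (r 0 * L.+1 + L).+1.
by move: H; lia.
Qed.

Lemma edge0 (S : node) (x : ma_mem A) : edge S node0 node0.
Proof.
by apply/existsP; exists x; apply/forallP => g; apply/forallP => q; rewrite ffunE inE.
Qed.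

Lemma card_grid : #|{: grid}| = n.+2 ^ h.
Proof. by rewrite card_ffun !card_ord. Qed.

Lemma card_node : #|{: node}| = 2 ^ (#|Q| * n.+2 ^ h).
Proof. by rewrite card_ffun card_grid -cardsT -powersetT card_powerset cardsT expnM. Qed.

Lemma accepts_reach2 k : stay_free -> clocked -> #|Q| * n.+2 ^ h <= k ->
  ma_accepts A w <->
  exists S : node, ma_init A \in S grid1 /\ reach2 (edge S) k S node0.
Proof.
move=> Hs Hc Hk; split=> [Ha|[S [HS /reach2_connect HR]]]; last exact: connect_accepts HR.
have [mu _] := Ha; have [S [HS HR]] := accepts_connect Hs Ha.
exists S; split=> //; apply: connect_reach2 HR; first exact: edge0 (mu 0).
by rewrite card_node leq_exp2l.
Qed.
End Chain.

(** * Eliminating steps that leave the memory position unchanged *)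

Section StayFree.
Variables (Sigma : finType) (h : nat) (A : mem_automaton Sigma h).
Let Q := ma_state A.
Let D := ma_mem A.

(* A cell of A becomes a block of cells: Some x opens a block with content x and
   None continues it.  A state inl (q, o) simulates q, with o the content of the
   current block unless it is about to be read; inr q skips to the next block. *)
Definition sf_state : finType := option (Q * option D + Q)%type.
Definition sf_mem : finType := option D.

Definition sf_go (q : Q) (y : {ffun 'I_h -> endmarked Sigma}) (x : D) :
    sf_state * {ffun 'I_h -> move} * option W15_mark :=
  let: (q', ms, e) := ma_trans q y x in
  match e with
  | None => (Some (inl (q', Some x)), ms, Some MarkPlus)
  | Some MarkPlus => (Some (inr q'), ms, Some MarkPlus)
  | Some MarkMinus => (Some (inl (q', None)), ms, Some MarkMinus)
  end.

Definition sf_trans (st : sf_state) (y : {ffun 'I_h -> endmarked Sigma}) (x : sf_mem) :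
    sf_state * {ffun 'I_h -> move} * option W15_mark :=
  match st, x with
  | Some (inl (q, Some x')), None => sf_go q y x'
  | Some (inl (q, None)), Some x' => sf_go q y x'
  | Some (inr q), Some x' => sf_go q y x'
  | Some (inr q), None => (st, [ffun=> Stay], Some MarkPlus)
  | _, _ => (None, [ffun=> Stay], Some MarkPlus)
  end.

Definition sf_acc : {set sf_state} :=
  [set st | match st with
            | Some (inl (q, _)) => q \in ma_acc A
            | Some (inr q) => q \in ma_acc A
            | None => false
            end].

Definition sf_automaton : mem_automaton Sigma h :=
  MemAutomaton sf_trans (Some (inl (ma_init A, None))) sf_acc.

Lemma sf_stay_free : stay_free sf_automaton.
Proof.
move=> st y x; rewrite /= /sf_trans /sf_go.
by case: st => [[[q [x'|]]|q]|]; case: x => [x''|] //; case: (ma_trans _ _ _) => [[q' ms] [[]|]].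
Qed.

Lemma move_stay_heads n (v : {ffun 'I_h -> nat}) :
  [ffun i => move_input n ([ffun=> Stay] i) (v i)] = v.
Proof. by apply/ffunP => i; rewrite !ffunE. Qed.

Section Forth.
Variables (w : seq Sigma) (mu : nat -> D) (T : nat).
(** The block length: within [T] steps the automaton stays in a cell at most [T] times, so it never
    runs out of continuation cells. *)
Let J := T.+1.
Definition sf_spread (x : nat) : sf_mem := if J %| x then Some (mu (x %/ J)) else None.
Let run' := @ma_run _ _ sf_automaton w sf_spread.

(** Either the simulation is [s] stay steps inside the block of the current cell, or it is on its
    way to the opening of that block, at most one block length before it. *)
Definition sf_sim (t : nat) (c : ma_conf A) (c' : ma_conf sf_automaton) : Prop :=
  mc_heads c' = mc_heads c /\
  ((exists s, [/\ s <= t, mc_cell c' = mc_cell c * J + s &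
      mc_state c' = Some (inl (mc_state c, if s == 0 then None else Some (mu (mc_cell c))))]) \/
   [/\ mc_cell c' <= mc_cell c * J, mc_cell c * J < mc_cell c' + J &
       mc_state c' = Some (inr (mc_state c))]).

Lemma sf_spread_mul c : sf_spread (c * J) = Some (mu c).
Proof. by rewrite /sf_spread dvdn_mull // mulnK. Qed.

Lemma sf_spread_add c s : 0 < s < J -> sf_spread (c * J + s) = None.
Proof. by move=> Hs; rewrite /sf_spread dvdn_addr ?dvdn_mull // gtnNdvd //; lia. Qed.

Lemma sf_wait t' c q hd : run' t' = MaConf (Some (inr q) : ma_state sf_automaton) hd c ->
  forall k, c <= k * J -> k * J < c + J -> exists t'',
  run' t'' = MaConf (Some (inr q) : ma_state sf_automaton) hd (k * J).
Proof.
move=> E k; have [m Hm] := ubnP (k * J - c); elim: m t' c E Hm => // m IH t' c E Hm H1 H2.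
case: (eqVneq c (k * J)) => [<-|Hc]; first by exists t'.
apply: (IH t'.+1 c.+1); try lia.
rewrite /run' ma_runS -/(run' t') E /ma_step /=.
have -> : sf_spread c = None.
  case: k H1 H2 Hc {Hm IH} => [|k]; first by rewrite mul0n; lia.
  rewrite mulSn => H1 H2 Hc.
  rewrite (_ : c = k * J + (c - k * J)); last by lia.
  by apply: sf_spread_add; lia.
by rewrite /sf_trans move_stay_heads.
Qed.

Lemma sf_forth t : t <= T -> exists t', sf_sim t (ma_run w mu t) (run' t').
Proof.
elim: t => [|t IH] Ht.
  by exists 0; split=> //; left; exists 0.
have [t' [Eh Hst]] := IH (ltnW Ht).
set c := ma_run w mu t in Eh Hst *.
have go t1 k s : s <= t -> k = mc_cell c -> mc_cell (run' t1) = k * J + s ->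
   mc_heads (run' t1) = mc_heads c ->
   sf_trans (mc_state (run' t1)) [ffun i => input_at w (mc_heads c i)] (sf_spread (k * J + s))
   = sf_go (mc_state c) [ffun i => input_at w (mc_heads c i)] (mu k) ->
   exists t', sf_sim t.+1 (ma_run w mu t.+1) (run' t').
  move=> Hs -> Ec Eh1 Etr; exists t1.+1; rewrite /run' ma_runS -/(run' t1) ma_runS -/c.
  rewrite /ma_step Eh1 Ec /= Etr /sf_go.
  case: (ma_trans _ _ _) => [[q' ms] [[]|]] /=; split=> //.
  - by right; split=> //=; rewrite mulSn /J; lia.
  - by left; exists 0.
  - by left; exists s.+1; split=> //=; lia.
case: Hst => [[s [Hs Ec Es]]|[H1 H2 Es]].
  apply: (go t' _ s Hs (erefl _) Ec Eh); rewrite Es; case: eqP => [->|Hs0].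
    by rewrite addn0 sf_spread_mul.
  by rewrite sf_spread_add //; lia.
have Er : run' t' = MaConf (Some (inr (mc_state c)) : ma_state sf_automaton) (mc_heads c) (mc_cell (run' t')).
  by case: (run' t') Eh Es => ? ? ? /= -> ->.
have [t1 E1] := sf_wait Er H1 H2.
by apply: (go t1 _ 0 isT (erefl _)); rewrite E1 ?addn0 //= sf_spread_mul.
Qed.
End Forth.

Section Back.
Variables (w : seq Sigma) (x0 : D) (mu' : nat -> sf_mem) (T : nat).
Definition somes (x : nat) : seq D := pmap id (mkseq mu' x).
Definition sf_collect (c : nat) : D := nth x0 (somes T.+1) c.
Let run' := @ma_run _ _ sf_automaton w mu'.

Lemma somesS x : somes x.+1 = if mu' x is Some y then rcons (somes x) y else somes x.
Proof.
rewrite /somes /mkseq -addn1 iotaD map_cat pmap_cat /= add0n.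
by case: (mu' x) => [y|] /=; rewrite ?cats1 ?cats0.
Qed.

Lemma sf_collect_rcons x y : x <= T -> mu' x = Some y -> sf_collect (size (somes x)) = y.
Proof.
move=> Hx Hy; rewrite /sf_collect.
have [s ->] : exists s, somes T.+1 = somes x.+1 ++ s.
  rewrite /somes /mkseq -(subnKC (_ : x.+1 <= T.+1)) // iotaD map_cat pmap_cat.
  by eexists.
by rewrite somesS Hy nth_cat size_rcons ltnSn nth_rcons ltnn eqxx.
Qed.

(** A guessed memory may have blocks of any lengths, so the simulated cell is identified by counting
    the blocks opened before the current position: this count is the cell itself while skipping to
    its block, and one more inside the block. A block that is too short or too long leads to the
    dead state [None]. *)
Definition sf_back_sim (c' : ma_conf sf_automaton) : Prop :=
  mc_state c' = None \/
  exists t, let c := ma_run w sf_collect t in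
    mc_heads c' = mc_heads c /\
    match mc_state c' with
    | None => True
    | Some (inl (q, None)) => [/\ q = mc_state c, mc_cell c' = 0 & mc_cell c = 0]
    | Some (inl (q, Some x)) =>
        [/\ q = mc_state c, size (somes (mc_cell c')) = (mc_cell c).+1 & sf_collect (mc_cell c) = x]
    | Some (inr q) => q = mc_state c /\ size (somes (mc_cell c')) = mc_cell c
    end.

Lemma sf_back t' : t' <= T -> mc_cell (run' t') <= t' /\ sf_back_sim (run' t').
Proof.
elim: t' => [|t' IH] Ht'.
  by split=> //; right; exists 0.
have [Hcell Hst] := IH (ltnW Ht').
rewrite /run' ma_runS -/(run' t'); set c' := run' t' in Hcell Hst *.
split.
  by rewrite /ma_step; case: (ma_trans _ _ _) => [[q ms] [[]|]] /=; lia.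
case: Hst => [E|[t]]; first by left; rewrite /ma_step E.
set c := ma_run w sf_collect t => /= -[Eh Hst].
have go x : sf_collect (mc_cell c) = x -> size (somes (mc_cell c').+1) = (mc_cell c).+1 ->
   @ma_trans _ _ sf_automaton (mc_state c') [ffun i => input_at w (mc_heads c' i)] (mu' (mc_cell c'))
   = sf_go (mc_state c) [ffun i => input_at w (mc_heads c i)] x ->
   sf_back_sim (@ma_step _ _ sf_automaton w mu' c').
  move=> Ex Es Etr; right; exists t.+1; rewrite ma_runS -/c /ma_step Etr /sf_go Ex Eh.
  by case: (ma_trans _ _ _) => [[q' ms] [[]|]] /=.
have Hle : mc_cell c' <= T by lia.
have dead : @ma_trans _ _ sf_automaton (mc_state c') [ffun i => input_at w (mc_heads c' i)]
    (mu' (mc_cell c')) = (None, [ffun=> Stay], Some MarkPlus) ->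
    mc_state (@ma_step _ _ sf_automaton w mu' c') = None.
  by rewrite /ma_step => ->.
case Es : (mc_state c') Hst => [[[q [x|]]|q]|] Hst; last by left; rewrite /ma_step Es.
- case Em : (mu' (mc_cell c')) => [y|]; first by left; apply: dead; rewrite Es Em.
  case: Hst => Eq Hsz Ex; apply: (go x Ex); first by rewrite somesS Em.
  by rewrite Es Em Eh Eq.
- case Em : (mu' (mc_cell c')) => [y|]; last by left; apply: dead; rewrite Es Em.
  case: Hst => Eq E0 E1; apply: (go y).
  + by rewrite E1 -(sf_collect_rcons Hle Em) E0.
  + by rewrite somesS Em size_rcons E0 E1.
  + by rewrite Es Em Eh Eq.
- case: Hst => Eq Hsz; case Em : (mu' (mc_cell c')) => [y|].
    apply: (go y); first by rewrite -Hsz; exact: sf_collect_rcons.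
      by rewrite somesS Em size_rcons Hsz.
    by rewrite Es Em Eh Eq.
  right; exists t; rewrite -/c /ma_step Es Em /= move_stay_heads.
  by rewrite somesS Em.
Qed.
End Back.

Lemma sf_accepts (x0 : D) w : ma_accepts sf_automaton w <-> ma_accepts A w.
Proof.
split=> -[mu [T HT]].
  exists (sf_collect x0 mu T).
  have [_] := sf_back w x0 mu (leqnn T); case=> [E|[t [_ H]]]; first by move: HT; rewrite E inE.
  exists t; move: HT H; rewrite inE.
  case: (mc_state _) => [[[q [x|]]|q]|] // Hq; first by case=> <-.
    by case=> <-.
  by case=> <-.
exists (sf_spread mu T).
have [t' [_ H]] := sf_forth w mu (leqnn T); exists t'; rewrite inE.
by case: H => [[s [_ _ ->]]|[_ _ ->]].
Qed.
End StayFree.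

(** * Bounding the number of memory resets *)

Section Clock.
Variables (Sigma : finType) (h : nat) (A : mem_automaton Sigma h).
Hypothesis A_stay_free : stay_free A.
Let Q := ma_state A.
(** With this many digits the initial counter value is at least [(n + 2) ^ (h + #|Q|)], hence at
    least [#|Q| * (n + 2) ^ h], the bound of [reset_count]. *)
Let d := (h + #|Q|).+1.

(** The counter pays for each reset. The dead state moves forward for ever, so the automaton remains
    stay-free and makes no reset after its budget is spent. *)
Definition ck_trans (st : option Q) (y : {ffun 'I_h -> endmarked Sigma})
    (z : {ffun unit -> bool}) (x : ma_mem A) :
    option Q * {ffun 'I_h -> move} * {ffun unit -> move} * option W15_mark :=
  let dead := (None, [ffun=> Stay], [ffun=> Stay], Some MarkPlus) in
  if st is Some q then
    let: (q', ms, e) := ma_trans q y x in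
    if e is Some MarkMinus then
      if z tt then dead else (Some q', ms, [ffun=> MoveL], e)
    else (Some q', ms, [ffun=> Stay], e)
  else dead.

Definition ck_mach : cmach Sigma 'I_h unit :=
  @CMach Sigma 'I_h unit (option Q) (ma_mem A) ck_trans (Some (ma_init A))
    [set st | if st is Some q then q \in ma_acc A else false].

Definition ck_automaton := compile d ck_mach.

Lemma ck_stay_free : stay_free ck_automaton.
Proof.
move=> [st s] y x; rewrite /= /ck_trans; case: st => [q|] //.
have := A_stay_free q [ffun i => y (enum_rank (inl i : cm_index 'I_h unit d))] x.
by case: (ma_trans _ _ _) => [[q' ms] [[]|]] //= _; case: ifP.
Qed.

Lemma ck_clocked w : clocked ck_automaton w.
Proof.
move=> mu; exists (fun t => cc_cnt (cm_run d w mu t) tt) => t.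
have [_ _ _ /(_ tt) [Hlt _]] := represents_run d w mu t.
rewrite !compile_cell; move: Hlt.
have -> : cm_run d w mu t.+1 = cm_step d w mu (cm_run d w mu t) by [].
set c := cm_run d w mu t => Hlt.
rewrite /cm_step /= /ck_trans; case: (cc_state c) => [q|]; last by left; rewrite ffunE ffunE.
have := A_stay_free q [ffun i => input_at w (cc_heads c i)] (mu (cc_cell c)).
case: (ma_trans _ _ _) => [[q' ms] [[]|]] //= _; first by left; rewrite ffunE ffunE.
rewrite ffunE; case: eqP => Hz /=; first by left; rewrite ffunE ffunE.
have Hz' : 0 < cc_cnt c tt by rewrite lt0n; apply/eqP.
by right; split=> //; rewrite ffunE ffunE move_counter_pred ?Hz' ?Hlt // ltn_predL.
Qed.

Lemma ck_sound w : cm_accepts d ck_mach w -> ma_accepts A w.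
Proof.
case=> mu [t Ht]; exists mu, t; move: Ht.
suff : cc_state (cm_run d w mu t : cm_conf ck_mach) = None \/
  [/\ cc_state (cm_run d w mu t : cm_conf ck_mach) = Some (mc_state (ma_run w mu t)),
      cc_heads (cm_run d w mu t : cm_conf ck_mach) = mc_heads (ma_run w mu t) &
      cc_cell (cm_run d w mu t : cm_conf ck_mach) = mc_cell (ma_run w mu t)].
  by case=> [->|[-> _ _]]; rewrite inE.
elim: t => [|t IH]; first by right.
have -> : cm_run d w mu t.+1 = cm_step d w mu (cm_run d w mu t : cm_conf ck_mach) by [].
rewrite ma_runS /cm_step /ma_step /=; case: IH => [->|[-> -> ->]]; first by left.
rewrite /ck_trans; case: (ma_trans _ _ _) => [[q' ms] [[]|]] /=; try by right.
by case: ifP => _; [left|right].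
Qed.

Lemma ma_conf_eq (c c' : ma_conf A) : mc_state c = mc_state c' ->
  mc_heads c = mc_heads c' -> mc_cell c = mc_cell c' -> c = c'.
Proof. by case: c; case: c' => ? ? ? ? ? ? /= -> -> ->. Qed.

(** Before the first accepting time no configuration repeats, since cutting out the loop would give
    an earlier acceptance. Right after a reset the cell is 0, so the configuration is determined by
    the state and the head positions, which leaves [#|Q| * (n + 2) ^ h] possibilities. *)
Lemma reset_count w mu T : mc_state (ma_run w mu T) \in ma_acc A ->
  (forall t, mc_state (ma_run w mu t) \in ma_acc A -> T <= t) ->
  count (fun t => mc_cell (ma_run w mu t.+1) == 0) (iota 0 T) <= #|Q| * (size w).+2 ^ h.
Proof.
move=> HT Hmin.
have inj i j : i < j <= T -> ma_run w mu i <> ma_run w mu j.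
  move=> Hij E; suff : T <= T - j + i by lia.
  apply: Hmin; rewrite /ma_run iterD -/(ma_run w mu i) E -iterD subnK //; lia.
rewrite -size_filter; set s := filter _ _.
pose f t := (mc_state (ma_run w mu t.+1), to_grid w (mc_heads (ma_run w mu t.+1))).
have Hs t : t \in s -> t < T /\ mc_cell (ma_run w mu t.+1) = 0.
  by rewrite mem_filter mem_iota => /andP [/eqP -> /=]; lia.
have Hu : uniq (map f s).
  rewrite map_inj_in_uniq ?filter_uniq ?iota_uniq // => t t' /Hs [Ht Ec] /Hs [Ht' Ec'] [Es Eg].
  have E : ma_run w mu t.+1 = ma_run w mu t'.+1.
    have [g Hg] := run_ghead w mu t.+1; have [g' Hg'] := run_ghead w mu t'.+1.
    have gK g0 : to_grid w (ghead g0) = g0.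
      by apply/ffunP => i; rewrite !ffunE inord_val.
    rewrite Hg Hg' !gK in Eg.
    by apply: ma_conf_eq; rewrite ?Es ?Ec ?Ec' // Hg Hg' Eg.
  by case: (ltngtP t t') => // Htt; [case: (@inj t.+1 t'.+1)|case: (@inj t'.+1 t.+1)]; rewrite ?E //; lia.
rewrite -(size_map f) -(card_uniqP Hu).
apply: leq_trans (max_card _) _.
by rewrite card_prod card_grid.
Qed.

Lemma ck_complete w : ma_accepts A w -> cm_accepts d ck_mach w.
Proof.
case=> mu Hex.
case: (ex_minnP (P := fun t => mc_state (ma_run w mu t) \in ma_acc A) Hex) => T HT Hmin.
exists mu, T; rewrite inE.
pose crun := @cm_run _ _ _ d ck_mach w mu; rewrite -/(crun T).
have Hb := reset_count HT Hmin.
set R := fun t => count (fun t => mc_cell (ma_run w mu t.+1) == 0) (iota 0 t).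
have RS t : R t.+1 = R t + (mc_cell (ma_run w mu t.+1) == 0).
  have E : iota 0 t.+1 = iota 0 t ++ [:: t] by rewrite -addn1 iotaD.
  by rewrite /R E count_cat /= addn0.
have Rmono t k : R t <= R (t + k).
  by elim: k => [|k IH]; rewrite ?addn0 // addnS RS; lia.
set B := repunit (size w).+2 d.
have HB : R T <= B.
  apply: leq_trans Hb (leq_trans _ (repunit_ge _ _)).
  rewrite mulnC expnD leq_mul2l; apply/orP; right.
  apply: leq_trans (ltnW (ltn_expl #|Q| (isT : 1 < 2))) _.
  by case: #|Q| => // k; rewrite leq_exp2r.
have HBN : B < (size w).+2 ^ d by exact: repunit_lt.
suff key t : t <= T ->
   [/\ cc_cnt (crun t) tt = B - R t,
       cc_state (crun t) = Some (mc_state (ma_run w mu t)),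
       cc_heads (crun t) = mc_heads (ma_run w mu t) &
       cc_cell (crun t) = mc_cell (ma_run w mu t)].
  by have [_ -> _ _] := key T (leqnn T).
elim: t => [|t IH] Ht; first by split=> //=; rewrite ffunE /R /= subn0.
have [En Es Eh Ec] := IH (ltnW Ht).
have HR : R t.+1 <= B by apply: leq_trans HB; rewrite -(subnKC Ht).
move: HR; rewrite RS ma_runS.
rewrite (_ : crun t.+1 = cm_step d (A := ck_mach) w mu (crun t)) //.
rewrite /cm_step /ma_step /= Es Eh Ec /ck_trans.
have := A_stay_free (mc_state (ma_run w mu t))
  [ffun i => input_at w (mc_heads (ma_run w mu t) i)] (mu (mc_cell (ma_run w mu t))).
case: (ma_trans _ _ _) => [[q' ms] [[]|]] //= _ HR.
  by split=> //=; rewrite ffunE ffunE /= En addn0.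
rewrite ffunE En (_ : (B - R t == 0) = false) /=; last by lia.
split=> //=; rewrite ffunE ffunE En move_counter_pred; first lia.
by move: HR HBN; move: (_ ^ _) => N; lia.
Qed.

Lemma ck_accepts w : ma_accepts ck_automaton w <-> ma_accepts A w.
Proof.
by rewrite compile_accepts; split; [exact: ck_sound|exact: ck_complete].
Qed.
End Clock.

(** * Alternating games on words *)

Section Play.
Variables E U : finType.
Implicit Types (X Y : nat -> E * U) (P : (nat -> E * U) -> bool).

Definition upd X (p : nat) (c : E * U) : nat -> E * U := fun q => if q == p then c else X q.

Fixpoint play (k : nat) P X (p : nat) : bool :=
  if k is k'.+1 then [exists e, forall u, play k' P (upd X p (e, u)) p.+1] else P X.

Lemma play_add k l P X p : play (k + l) P X p = play k (fun Y => play l P Y (p + k)) X p.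
Proof.
elim: k X p => [|k IH] X p; first by rewrite /= addn0.
rewrite addSn /=; apply: eq_existsb => e; apply: eq_forallb => u.
by rewrite IH addSnnS.
Qed.

Definition agree_out X Y (p k : nat) := forall q, ~~ (p <= q < p + k) -> Y q = X q.

Lemma agree_out_updl X Y p k c : agree_out (upd X p c) Y p.+1 k ->
  agree_out X Y p k.+1 /\ Y p = c.
Proof.
move=> H; split=> [q Hq|]; last by rewrite H ?ltnn // /upd eqxx.
by rewrite H /upd; [case: eqP => // Eq; move: Hq; rewrite Eq; lia|lia].
Qed.

(** An oblivious existential strategy: the letters [f q] are fixed beforehand and beat every
    universal answer. *)
Lemma play_intro k P X p (f : nat -> E) :
  (forall Y, agree_out X Y p k -> (forall q, p <= q < p + k -> (Y q).1 = f q) -> P Y) ->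
  play k P X p.
Proof.
elim: k X p => [|k IH] X p HP /=; first by apply: HP => // q; lia.
apply/existsP; exists (f p); apply/forallP => u; apply: IH => Y /agree_out_updl [H1 H2] HY.
apply: HP => // q Hq; case: (eqVneq q p) => [->|Hqp]; first by rewrite H2.
by apply: HY; lia.
Qed.

(** The dual: letting the universal player answer by a fixed sequence [g] yields one complete
    word. *)
Lemma play_elim k P X p (g : nat -> U) : play k P X p ->
  exists Y, [/\ agree_out X Y p k, forall q, p <= q < p + k -> (Y q).2 = g q & P Y].
Proof.
elim: k X p => [|k IH] X p /=; first by exists X; split=> // q; lia.
case/existsP => e /forallP /(_ (g p)) /IH [Y [/agree_out_updl [H1 H2] HY HP]].
exists Y; split=> // q Hq; case: (eqVneq q p) => [->|Hqp]; first by rewrite H2.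
by apply: HY; lia.
Qed.
End Play.

(** * The boustrophedon enumeration of the grid *)

Section Boustrophedon.
Variable n : nat.
Let b := n.+2.

(** Digit [i] reverses at each of its overflows, of which there have been [p %/ b ^ i.+1], so parity
    tells the direction. It starts reversed because copying the input leaves the digit heads at the
    right end. *)
Definition sdir (p i : nat) : bool := ~~ odd (p %/ b ^ i.+1).
Definition spos (p i : nat) : nat := eff n (sdir p i) (dig b p i).

Lemma spos_le p i : spos p i <= n.+1.
Proof.
have : dig b p i < b by exact: dig_lt.
by rewrite /spos /eff /b; case: (sdir p i) => /=; lia.
Qed.

(** The inverse enumeration, from head positions back to the number. It works from the top digit
    down, because the direction of a digit is the parity of the number [k] formed by the digits
    above it. *)
Fixpoint unspos (m k : nat) (g : nat -> nat) : nat :=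
  if m is m'.+1 then unspos m' (k * b + eff n (~~ odd k) (g m')) g else k.

Lemma unsposP m k g : (forall i, i < m -> g i <= n.+1) ->
  unspos m k g %/ b ^ m = k /\ forall i, i < m -> spos (unspos m k g) i = g i.
Proof.
elim: m k => [|m IH] k Hg /=; first by rewrite divn1.
set k' := k * b + _; have [|E1 E2] := IH k'; first by move=> i Hi; apply: Hg; lia.
have He : eff n (~~ odd k) (g m) < b by have := Hg m (ltnSn m); rewrite /eff /b; case: ifP; lia.
have E3 : unspos m k' g %/ b ^ m.+1 = k by rewrite expnSr divnMA E1 /k' divnMDl // divn_small // addn0.
split=> // i; rewrite ltnS leq_eqVlt => /orP [/eqP ->|]; last exact: E2.
rewrite /spos /sdir E3 /dig E1 /k' modnMDl modn_small // effK //.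
exact: Hg.
Qed.

Lemma unsposK m p g : (forall i, i < m -> g i = spos p i) -> unspos m (p %/ b ^ m) g = p.
Proof.
elim: m => [|m IH] Hg /=; first by rewrite divn1.
rewrite Hg // /spos -/(sdir p m) effK; last by rewrite -ltnS; exact: dig_lt.
by rewrite -dig_div //; apply: IH => i Hi; apply: Hg; lia.
Qed.
End Boustrophedon.

(** * The game that decides the existence of a chain of labellings *)

Section Game.
Variables (Sigma : finType) (h : nat) (A : mem_automaton Sigma h) (w : seq Sigma) (K : nat).
Let n := size w.
Let b := n.+2.
Let Q := ma_state A.
Let grid := grid h w.
Let node := node A w.
Definition choice_E : finType := ({set Q} * ma_mem A)%type.
Definition choice_U : finType := option {ffun 'I_h -> move}.
Let word := nat -> choice_E * choice_U.
Let N := b ^ h.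

Definition gvec (p : nat) : grid := [ffun i : 'I_h => inord (spos n p i)].
(** The default 0 concerns only indices from [h] on, which [unspos] with [h] digits never looks
    up. *)
Definition gpos (k : nat) (g : grid) : nat :=
  unspos n h k (fun i => oapp (fun j : 'I_h => g j : nat) 0 (insub i)).

Lemma gvecE p i : gvec p i = spos n p i :> nat.
Proof. by rewrite ffunE inordK // ltnS spos_le. Qed.

Lemma gposP k g : gpos k g %/ N = k /\ gvec (gpos k g) = g.
Proof.
rewrite /gpos; set f := fun i => _.
have [|E1 E2] := @unsposP n h k f.
  by move=> i Hi; rewrite /f insubT /= -ltnS.
split=> //; apply/ffunP => i; apply: val_inj; rewrite /= gvecE E2 //.
by rewrite /f insubT //= => Hi; congr (val (g _)); apply: val_inj.
Qed.

Lemma gposK p : gpos (p %/ N) (gvec p) = p.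
Proof. by apply: unsposK => i Hi; rewrite insubT /= gvecE. Qed.

Lemma N_gt0 : 0 < N.
Proof. by rewrite expn_gt0. Qed.

Lemma gpos_range k g : k * N <= gpos k g < k.+1 * N.
Proof. by case: (gposP k g) => E _; rewrite -leq_divRL ?N_gt0 // -ltn_divLR ?N_gt0 // E leqnn ltnSn. Qed.

(* The word has K + 2 blocks of N cells.  Block 0 labels memory cell 0; blocks 1
   to K are the midpoints of the halving, and the last universal choice in such a
   block selects a half; the first cell of the last block gives the memory symbol
   and its last universal choice other than None the point to be checked. *)
Definition label (X : word) (k : nat) : node := [ffun g => (X (gpos k g)).1.1].
Definition bit (X : word) (k : nat) : bool := (X (k * N + N.-1)).2 != None.
Fixpoint ends (X : word) (k : nat) : node * node :=
  if k is k'.+1 then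
    if bit X k then (label X k, (ends X k').2) else ((ends X k').1, label X k)
  else (label X 0, node0 A w).
Definition symb (X : word) : ma_mem A := (X (K.+1 * N)).1.2.
Fixpoint challenge (X : word) (c : nat) : option (nat * {ffun 'I_h -> move}) :=
  if c is c'.+1 then
    if (X (K.+1 * N + c')).2 is Some ms then Some (K.+1 * N + c', ms) else challenge X c'
  else None.

(** Only transitions with the challenged head moves [ms] are tested. All of them lead to the same
    grid point, so labels at two points suffice: [a] and [s1] at the challenged point, [b] and [s2]
    at its successor. *)
Definition check (y : {ffun 'I_h -> endmarked Sigma}) (one : bool)
    (ms : {ffun 'I_h -> move}) (x : ma_mem A) (a b s1 s2 : {set Q}) : bool :=
  (one ==> (ma_init A \in s1)) &&
  [forall q in a, (q \in ma_acc A) ||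
    let: (q', ms', e) := ma_trans q y x in
    (ms' == ms) ==>
    match e with
    | Some MarkPlus => q' \in b
    | Some MarkMinus => q' \in s2
    | None => false
    end].

Definition leaf (X : word) : bool :=
  if challenge X N is Some (p, ms) then
    let g := gvec p in
    check (gsyms g) (g == grid1 h w) ms (symb X)
      ((ends X K).1 g) ((ends X K).2 (gmove ms g)) (label X 0 g) (label X 0 (gmove ms g))
  else true.

Lemma label_ext X Y k l : k < l -> (forall p, p < l * N -> Y p = X p) -> label Y k = label X k.
Proof.
move=> Hkl H; apply/ffunP => g; rewrite !ffunE H //.
by have /andP [_ Hlt] := gpos_range k g; apply: leq_trans Hlt _; rewrite leq_mul2r Hkl orbT.
Qed.

Lemma ends_ext X Y k l : k < l -> (forall p, p < l * N -> Y p = X p) -> ends Y k = ends X k.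
Proof.
move=> Hkl H; elim: k Hkl => [|k IH] Hkl /=; first by rewrite (label_ext Hkl H).
rewrite (IH (ltnW Hkl)) (label_ext Hkl H) /bit H //.
have := N_gt0; nia.
Qed.

Lemma challenge_only X c p ms : p < c -> (X (K.+1 * N + p)).2 = Some ms ->
  (forall q, q < c -> q != p -> (X (K.+1 * N + q)).2 = None) ->
  challenge X c = Some (K.+1 * N + p, ms).
Proof.
move=> Hp HX; elim: c Hp => // c IH Hp Hn /=.
case: (eqVneq c p) => [->|Hcp]; first by rewrite HX.
rewrite Hn //; apply: IH => [|q Hq]; first lia.
by apply: Hn; lia.
Qed.

(** The first letter of the last block commits to a memory symbol that must work for all states and
    grid points; the universal player then names one grid point and one vector of moves, and an edge
    is exactly the absence of a winning challenge. *)
Lemma play_tail X : play N leaf X (K.+1 * N) <->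
  ma_init A \in label X 0 (grid1 h w) /\ edge (label X 0) (ends X K).1 (ends X K).2.
Proof.
have N0 := N_gt0; set p0 := K.+1 * N.
have Hext Y : (forall q, q < p0 -> Y q = X q) -> (label Y 0 = label X 0) * (ends Y K = ends X K).
  by move=> H; rewrite (@label_ext X Y 0 K.+1) // (@ends_ext X Y K K.+1).
split.
  have {1}-> : N = N.-1.+1 by lia.
  case/existsP => -[s x] /forallP Hu.
  have key g ms : check (gsyms g) (g == grid1 h w) ms x ((ends X K).1 g)
      ((ends X K).2 (gmove ms g)) (label X 0 g) (label X 0 (gmove ms g)).
    (* The universal player answers [None] everywhere except at the cell of [g], so [challenge]
       finds exactly this point. *)
    pose p := gpos K.+1 g; pose f q : choice_U := if q == p then Some ms else None.
    have [Y [/agree_out_updl [H1 H2] H3]] := play_elim f (Hu (f p0)).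
    have Hp := gpos_range K.+1 g; rewrite -/p in Hp.
    have Hf q : q < N -> (Y (p0 + q)).2 = f (p0 + q).
      case: q => [|q] Hq; first by rewrite addn0 H2.
      by apply: H3; lia.
    rewrite /leaf (@challenge_only Y N (p - p0) ms).
    - rewrite subnKC; last by rewrite /p0; lia.
      have [_ ->] := gposP K.+1 g; rewrite /symb -/p0 H2.
      by have [|-> ->] := Hext Y; first by move=> q Hq; apply: H1; lia.
    - by rewrite /p0; lia.
    - by rewrite Hf /f; [rewrite subnKC ?eqxx //; rewrite /p0|rewrite /p0]; lia.
    - by move=> q Hq Hqp; rewrite Hf // /f ifN //; lia.
  split.
    by have /andP [/implyP ->] := key (grid1 h w) [ffun=> Stay].
  apply/existsP; exists x; apply/forallP => g; apply/forallP => q; apply/implyP => Hq.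
  rewrite /good_move.
  (* The state [q] is tested by challenging with the very moves of its own transition. *)
  have /andP [_ /forallP /(_ q) /implyP /(_ Hq)] := key g (ma_trans q (gsyms g) x).1.2.
  by case: (ma_trans _ _ _) => [[q' ms] e] /=; rewrite eqxx.
case=> Hi /existsP [x /forallP Hx].
apply: (@play_intro _ _ _ _ _ _ (fun=> (set0, x))) => Y H1 H2.
have [|E1 E2] := Hext Y; first by move=> q Hq; apply: H1; rewrite -/p0; lia.
rewrite /leaf E1 E2 /symb -/p0 H2 /=; last by rewrite -/p0; lia.
case: (challenge Y N) => // -[p ms]; apply/andP; split.
  by apply/implyP => /eqP ->.
apply/forallP => q; apply/implyP => Hq.
move/forallP: (Hx (gvec p)) => /(_ q) /implyP /(_ Hq); rewrite /good_move.
case: (ma_trans _ _ _) => [[q' ms'] e] /orP [->//|H]; apply/orP; right.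
by apply/implyP => /eqP <-.
Qed.

(** Each block writes down a midpoint, and the bit selecting a half is the universal answer to its
    last cell. It comes after all labels of the block are fixed, so one midpoint has to serve both
    halves. *)
Lemma play_levels r X : r <= K ->
  play (r * N + N) leaf X ((K - r).+1 * N) <->
  ma_init A \in label X 0 (grid1 h w) /\
  reach2 (edge (label X 0)) r (ends X (K - r)).1 (ends X (K - r)).2.
Proof.
have N0 := N_gt0.
elim: r X => [|r IH] X Hr; first by rewrite mul0n add0n subn0 play_tail.
have Ek : (K - r.+1).+1 = K - r by lia.
set k := K - r.+1; rewrite -/k in Ek.
have -> : r.+1 * N + N = N + (r * N + N) by lia.
have Ep : k.+1 * N + N = (K - r).+1 * N by rewrite Ek mulSn; lia.
rewrite play_add Ep.
have Eb Y : (forall q, q < k.+1 * N -> Y q = X q) ->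
    (label Y 0 = label X 0) * (ends Y k = ends X k).
  by move=> H; rewrite (@label_ext X Y 0 k.+1) // (@ends_ext X Y k k.+1).
split.
  have {1}-> : N = N.-1 + 1 by lia.
  rewrite play_add => /(play_elim (fun=> None)) [Y [H1 _]] /= /existsP [e /forallP Hu].
  pose Z u := upd Y (k.+1 * N + N.-1) (e, u).
  have HZ u : agree_out X (Z u) (k.+1 * N) N.
    by move=> q Hq; rewrite /Z /upd ifN; [apply: H1|]; lia.
  have {}Hu u : ma_init A \in label (Z u) 0 (grid1 h w) /\
      reach2 (edge (label (Z u) 0)) r (ends (Z u) (K - r)).1 (ends (Z u) (K - r)).2.
    by apply/IH; [lia|exact: Hu].
  (* The two words differ only in a universal component, which labels ignore. *)
  have Hm u v : label (Z u) k.+1 = label (Z v) k.+1.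
    by apply/ffunP => g; rewrite !ffunE /Z /upd; case: eqP.
  have Hz u : (label (Z u) 0 = label X 0) * (ends (Z u) k = ends X k).
    by apply: Eb => q Hq; apply: HZ; lia.
  have Hbit u : bit (Z u) k.+1 = (u != None) by rewrite /bit /Z /upd eqxx.
  have [Hi R0] := Hu None; have [_ R1] := Hu (Some [ffun=> Stay]).
  move: Hi R0 R1; rewrite -Ek /= !Hbit !Hz /= => Hi R0 R1; split=> //.
  apply/existsP; exists (label (Z None) k.+1).
  by rewrite R0 (Hm _ (Some [ffun=> Stay])) R1.
case=> Hi /existsP [m /andP [R0 R1]].
have [x _] : exists x : ma_mem A, True.
  by have [a [c /existsP [x _]]] := reach2_edge R0; exists x.
apply: (@play_intro _ _ _ _ _ _ (fun q => (m (gvec q), x))) => Y H1 H2.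
apply/IH; first by lia.
have [|E1 E2] := Eb Y; first by move=> q Hq; apply: H1; lia.
have Em : label Y k.+1 = m.
  apply/ffunP => g; rewrite ffunE H2 /=; first by have [_ ->] := gposP k.+1 g.
  by have := gpos_range k.+1 g; lia.
by rewrite -Ek /= E1 E2 Em; split=> //; case: ifP.
Qed.

Theorem play_leaf X : play (K.+2 * N) leaf X 0 <->
  exists S : node, ma_init A \in S (grid1 h w) /\ reach2 (edge S) K S (node0 A w).
Proof.
have N0 := N_gt0.
have -> : K.+2 * N = N + (K * N + N) by lia.
rewrite play_add add0n.
have El Y : play (K * N + N) leaf Y N <-> ma_init A \in label Y 0 (grid1 h w) /\
    reach2 (edge (label Y 0)) K (label Y 0) (node0 A w).
  by have := @play_levels K Y (leqnn K); rewrite subnn mul1n.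
split.
  case/(play_elim (fun=> None)) => Y [_ _ /El HY]; by exists (label Y 0).
case=> S [Hi HR].
have [x _] : exists x : ma_mem A, True.
  by have [a [c /existsP [x _]]] := reach2_edge HR; exists x.
apply: (@play_intro _ _ _ _ _ _ (fun q => (S (gvec q), x))) => Y H1 H2.
apply/El; suff -> : label Y 0 = S by [].
apply/ffunP => g; rewrite ffunE H2 /=; first by have [_ ->] := gposP 0 g.
by have := gpos_range 0 g; lia.
Qed.
End Game.

(** * A Turing machine evaluating the game *)

Section Next.
Variables (T : finType) (x0 : T).
Definition first_elt : T := head x0 (enum T).
Definition later (x : T) : seq T := drop (index x (enum T)).+1 (enum T).
Definition next_elt (x : T) : option T := ohead (later x).

Lemma later_next x : later x = if next_elt x is Some y then y :: later y else [::].
Proof.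
rewrite /next_elt; case El : (later x) => [|y l] //=; congr (_ :: _).
have Hs : (index x (enum T)).+1 < size (enum T).
  by rewrite ltnNge; apply/negP => /drop_oversize; rewrite -/(later x) El.
have Ey : nth x0 (enum T) (index x (enum T)).+1 = y.
  by rewrite -[_.+1]addn0 -nth_drop -/(later x) El.
by rewrite /later -Ey index_uniq ?enum_uniq // -[_.+2]add1n -drop_drop -/(later x) El /= drop0.
Qed.

Lemma enum_first : enum T = first_elt :: later first_elt.
Proof.
have : x0 \in enum T by rewrite mem_enum.
rewrite /later /first_elt; case: (enum T) => // y l _ /=.
by rewrite eqxx drop0.
Qed.
End Next.

Lemma play_ext (E U : finType) k (P : (nat -> E * U) -> bool) X Y p :
  agree_out X Y p k -> play k P X p = play k P Y p.
Proof.
elim: k X Y p => [|k IH] X Y p H /=.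
  by congr P; apply: functional_extensionality => q; rewrite H //; lia.
apply: eq_existsb => e; apply: eq_forallb => u; apply: IH => q Hq.
rewrite /upd; case: eqP => // Hqp; apply: H; lia.
Qed.

Lemma upd_id (E U : finType) (X : nat -> E * U) p : upd X p (X p) = X.
Proof. by apply: functional_extensionality => q; rewrite /upd; case: eqP => // ->. Qed.

(* Zero runs right and completes the word by first letters.  Tail, Mark2 and Scan run
   left and evaluate the word: Tail finds the challenged point, which is marked on the
   digit tapes together with its successor (in Mark2), and Scan collects the labels
   there.  Back runs right and erases the marks, and Odo runs left to the next word. *)
Inductive ctrl (C D : Type) :=
  | Zero of bool | Tail | Mark2 of C | Scan of C & D | Back of bool | Odo of bool.
Arguments Zero {C D}. Arguments Tail {C D}. Arguments Mark2 {C D}.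
Arguments Back {C D}. Arguments Odo {C D}.

Section CtrlFinite.
Variables C D : Type.
Definition ctrl_encode (c : ctrl C D) : bool + unit + C + C * D + bool + bool :=
  match c with
  | Zero z => inl (inl (inl (inl (inl z))))
  | Tail => inl (inl (inl (inl (inr tt))))
  | Mark2 x => inl (inl (inl (inr x)))
  | Scan x y => inl (inl (inr (x, y)))
  | Back v => inl (inr v)
  | Odo v => inr v
  end.
Definition ctrl_decode (c : bool + unit + C + C * D + bool + bool) : ctrl C D :=
  match c with
  | inl (inl (inl (inl (inl z)))) => Zero z
  | inl (inl (inl (inl (inr tt)))) => Tail
  | inl (inl (inl (inr x))) => Mark2 x
  | inl (inl (inr (x, y))) => Scan x y
  | inl (inr v) => Back v
  | inr v => Odo v
  end.
Lemma ctrl_encodeK : cancel ctrl_encode ctrl_decode.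
Proof. by case. Qed.
End CtrlFinite.

HB.instance Definition _ (C D : finType) :=
  Finite.copy (ctrl C D) (can_type (@ctrl_encodeK C D)).

(** A work head is not stopped behind the copied right endmarker, so moves are cut off to agree with
    those of an input head. *)
Definition clamp (Sigma : finType) (m : move) (y : endmarked Sigma) : move :=
  match m with
  | MoveL => if y == LEnd then Stay else MoveL
  | Stay => Stay
  | MoveR => if y == REnd then Stay else MoveR
  end.
Definition opp_move (m : move) : move :=
  match m with MoveL => MoveR | Stay => Stay | MoveR => MoveL end.

Lemma move_clamp (Sigma : finType) (w : seq Sigma) m v : v <= (size w).+1 ->
  move_work (clamp m (input_at w v)) v = move_input (size w) m v.
Proof.
by case: m => //= Hv; rewrite ?input_at_REnd ?input_at_LEnd; case: ifP => /=; lia.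
Qed.

Lemma move_opp_clamp (Sigma : finType) (w : seq Sigma) m v : v <= (size w).+1 ->
  move_work (opp_move (clamp m (input_at w v))) (move_input (size w) m v) = v.
Proof.
by case: m => //= Hv; rewrite ?input_at_REnd ?input_at_LEnd; case: ifP => /=; lia.
Qed.

Section Machine.
Variables (Sigma : finType) (h d : nat) (A : mem_automaton Sigma h) (x0 : ma_mem A).
Let m := h + d.
Let Q := ma_state A.
Let E := choice_E A.
Let U := choice_U h.
Let cell := (E * U)%type.

Definition e0 : E := first_elt ((set0, x0) : E).
Definition u0 : U := first_elt (None : U).
Definition c0 : cell := (e0, u0).

(* The symbols, the position-1 flag and the moves of the challenge. *)
Definition chal : finType := ({ffun 'I_h -> endmarked Sigma} * bool * {ffun 'I_h -> move})%type.
(* The memory symbol, the bit of the current block, and the labels found so far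
   at the challenged point and at its successor. *)
Definition sdata : finType :=
  (ma_mem A * bool * (option {set Q} * option {set Q}) * ({set Q} * {set Q}))%type.

(** Met from the right, the left endpoint of the final segment is the first label whose block has
    its bit set, or block 0 if there is none; the right endpoint is the first one whose bit is not
    set, or empty. The tests for [None] keep the first find. In the last block the symbol is
    overwritten until its leftmost cell has been read. *)
Definition scan_upd (last first rend at1 at2 : bool) (D : sdata) (c : cell) : sdata :=
  let: (x, bt, (a, b), (s1, s2)) := D in
  if last then (c.1.2, bt, (a, b), (s1, s2)) else
  let bt' := if rend then c.2 != None else bt in
  (x, bt',
   (if [&& at1, bt' || first & a == None] then Some c.1.1 else a,
    if [&& at2, ~~ bt', ~~ first & b == None] then Some c.1.1 else b),
   (if first && at1 then c.1.1 else s1, if first && at2 then c.1.1 else s2)).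

Definition scan_check (ch : chal) (D : sdata) : bool :=
  let: (y, one, ms) := ch in
  let: (x, _, (a, b), (s1, s2)) := D in
  check y one ms x (odflt set0 a) (odflt set0 b) s1 s2.

Definition control : finType := (ctrl chal sdata * {ffun 'I_m -> bool} + bool)%type.

Definition low (T : Type) (f : 'I_h -> T) (t : T) (i : 'I_m) : T :=
  match split i with inl j => f j | inr _ => t end.

Definition post (c : ctrl chal sdata) (s : {ffun 'I_m -> bool})
    (y : {ffun 'I_m -> endmarked Sigma}) (one : {ffun 'I_m -> bool})
    (mk : {ffun 'I_m -> bool * bool}) (x : cell) :
    control * {ffun 'I_m -> bool * bool} * {ffun 'I_m -> move} * cell * move :=
  let stay c mk' x' := (inl (c, s), mk', [ffun=> Stay], x', Stay) in
  let go up c mk' x' :=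
    (inl (c, cnt_dir up s y), mk', cnt_move up s y, x', if up then MoveR else MoveL) in
  let low_ext up := [forall i, at_ext up s y (lshift d i)] in
  let high_ext up := [forall i, at_ext up s y (rshift h i)] in
  match c with
  | Zero z => let x' := if z then c0 else x in
      if all_ext true s y then stay Tail mk x' else go true (Zero true) mk x'
  | Tail =>
      if x.2 is Some ms then
        (inl (Mark2 ([ffun i => y (lshift d i)], [forall i, one (lshift d i)], ms), s),
         [ffun i => low (fun=> (true, false)) (mk i) i],
         [ffun i => low (fun j => clamp (ms j) (y i)) Stay i], x, Stay)
      else if low_ext false then stay (Back true) mk x else go false Tail mk x
  | Mark2 ch =>
      let: (y', _, ms) := ch in
      (inl (Scan ch (x0, false, (None, None), (set0, set0)), s),
       [ffun i => low (fun=> ((mk i).1, true)) (mk i) i],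
       [ffun i => low (fun j => opp_move (clamp (ms j) (y' j))) Stay i], x, Stay)
  | Scan ch D =>
      let D' := scan_upd (high_ext true) (high_ext false) (low_ext true)
        [forall i, (mk (lshift d i)).1] [forall i, (mk (lshift d i)).2] D x in
      if all_ext false s y then stay (Back (scan_check ch D')) mk x
      else go false (Scan ch D') mk x
  | Back v =>
      if all_ext true s y then stay (Odo v) [ffun=> (false, false)] x
      else go true (Back v) [ffun=> (false, false)] x
  | Odo v =>
      let left x' := if all_ext false s y then (inr v, mk, [ffun=> Stay], x', Stay)
                     else go false (Odo v) mk x' in
      if v then
        if next_elt x.2 is Some u then stay (Zero false) mk (x.1, u) else left x
      else
        if next_elt x.1 is Some e then stay (Zero false) mk (e, u0) else left x
  end.

(* Tape 0 holds the word.  The other tapes are copies of the endmarked input, with a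
   flag on position 1 and two marks; their heads are the digits of the position of
   head 0. *)
Definition dsym : finType := (endmarked Sigma * bool * (bool * bool))%type.
Definition tsym : finType := (dsym * cell)%type.
Definition tstate : finType := (option bool + control)%type.
(** The blank shows [REnd], the default of [input_at], so cells that were never written agree with
    [tapes]. *)
Definition dblank : dsym := (REnd, false, (false, false)).

Definition tape_act (dw : {ffun 'I_m -> dsym * move}) (xw : cell * move) :
    {ffun 'I_m.+1 -> tsym * move} :=
  [ffun j => match unlift ord0 j with
             | Some i => ((dw i).1, c0, (dw i).2)
             | None => (dblank, xw.1, xw.2)
             end].

Definition machine_trans (st : tstate) (a : endmarked Sigma) (y : {ffun 'I_m.+1 -> tsym}) :
    tstate * move * {ffun 'I_m.+1 -> tsym * move} :=
  let yd i := (y (lift ord0 i)).1 in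
  let x := (y ord0).2 in
  match st with
  | inl None => (inl (Some true), Stay,
      tape_act [ffun=> ((LEnd, false, (false, false)), MoveR)] (x, Stay))
  | inl (Some one) =>
      if a == REnd then
        (inr (inl (Zero false, [ffun=> true])), Stay,
         tape_act [ffun=> ((a, one, (false, false)), Stay)] (x, Stay))
      else (inl (Some false), MoveR,
            tape_act [ffun=> ((a, one, (false, false)), MoveR)] (x, Stay))
  | inr (inl (c, s)) =>
      let: (st', mk, dm, x', xm) :=
        post c s [ffun i => (yd i).1.1] [ffun i => (yd i).1.2] [ffun i => (yd i).2] x in
      (inr st', Stay, tape_act [ffun i => ((yd i).1, mk i, dm i)] (x', xm))
  | inr (inr v) => (st, Stay, [ffun j => (y j, Stay)])
  end.

Lemma machine_trans_post c s a (z : {ffun 'I_m.+1 -> tsym}) (y : {ffun 'I_m -> endmarked Sigma}) (one : {ffun 'I_m -> bool})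
    (mk : {ffun 'I_m -> bool * bool}) x :
  (forall i, z (lift ord0 i) = (y i, one i, mk i, c0)) -> z ord0 = (dblank, x) ->
  machine_trans (inr (inl (c, s))) a z =
  let: (st', mk', dm, x', xm) := post c s y one mk x in
  (inr st', Stay, tape_act [ffun i => (y i, one i, mk' i, dm i)] (x', xm)).
Proof.
move=> Hz Hx; rewrite /machine_trans Hx /=.
rewrite (_ : [ffun i => _] = y); last by apply/ffunP => i; rewrite ffunE Hz.
rewrite (_ : [ffun i => _] = one); last by apply/ffunP => i; rewrite ffunE Hz.
rewrite (_ : [ffun i => _] = mk); last by apply/ffunP => i; rewrite ffunE Hz.
case: (post _ _ _ _ _ _) => [[[[st' mk'] dm] x'] xm]; congr (_, tape_act _ _).
by apply/ffunP => i; rewrite !ffunE Hz.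
Qed.

Lemma accept_neq_reject : (inr (inr true) : tstate) != inr (inr false).
Proof. by []. Qed.

Definition machine : turing_machine Sigma m.+1 :=
  @TuringMachine Sigma m.+1 tstate tsym (dblank, c0) machine_trans (inl None)
    (inr (inr true)) (inr (inr false)) accept_neq_reject.

(** * Correctness and space of the machine on a fixed input *)

Section Run.
Variable w : seq Sigma.
Let n := size w.
Let b := n.+2.
Let M := b ^ m.
Let N := b ^ h.
Implicit Types (v : {ffun 'I_m -> nat}) (X : nat -> cell) (mk : 'I_m -> nat -> bool * bool).

Definition tapes X mk : 'I_m.+1 -> nat -> tsym := fun j y =>
  match unlift ord0 j with
  | Some i => (input_at w y, y == 1, mk i y, c0)
  | None => (dblank, X y)
  end.

Definition heads v (p : nat) : {ffun 'I_m.+1 -> nat} :=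
  [ffun j => if unlift ord0 j is Some i then v i else p].

Definition cfg (st : control) v p X mk : tm_conf machine :=
  @TmConf _ _ machine (inr st) n.+1 (heads v p) (tapes X mk).

Lemma step_post c s v p X mk :
  let: (st', mk', dm, x', xm) :=
    post c s [ffun i => input_at w (v i)] [ffun i => v i == 1] [ffun i => mk i (v i)] (X p) in
  tm_step w (cfg (inl (c, s)) v p X mk) =
  cfg st' [ffun i => move_work (dm i) (v i)] (move_work xm p) (upd X p x')
    (fun i y => if y == v i then mk' i else mk i y).
Proof.
rewrite /tm_step (_ : tm_halted _ = false) // [tm_trans _ _ _](@machine_trans_post c s _ _
  [ffun i => input_at w (v i)] [ffun i => v i == 1] [ffun i => mk i (v i)] (X p)); first last.
- by rewrite ffunE /= /tapes /heads ffunE unlift_none.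
- by move=> i; rewrite !ffunE /= /tapes ?ffunE !liftK.
case: (post _ _ _ _ _ _) => [[[[st' mk'] dm] x'] xm] /=.
rewrite /cfg; congr TmConf.
- by apply/ffunP => j; rewrite !ffunE; case: (unliftP ord0 j) => [i _|_]; rewrite ?ffunE.
- apply: functional_extensionality => j; apply: functional_extensionality => y.
  rewrite /tapes !ffunE /upd; case: (unliftP ord0 j) => [i _|_]; rewrite ?ffunE //.
  + by case: eqP => // ->.
  + by case: eqP.
Qed.

Hypothesis d_gt0 : 0 < d.
(** The [K + 2] blocks number exactly [b ^ d], so a position in the word has [h + d] digits: the low
    [h] give the grid point and the high [d] the block. *)
Let K := b ^ d - 2.

Lemma blocks_eq : b ^ d = K.+2.
Proof.
have : b ^ 1 <= b ^ d by rewrite leq_exp2l.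
by rewrite expn1 /K /b; lia.
Qed.

Lemma length_eq : M = K.+2 * N.
Proof. by rewrite /M /m expnD blocks_eq mulnC. Qed.

Definition vp (p : nat) : {ffun 'I_m -> nat} := [ffun i : 'I_m => spos n p i].
Definition sp (p : nat) : {ffun 'I_m -> bool} := [ffun i : 'I_m => sdir n p i].

Lemma vp_le p i : vp p i <= n.+1.
Proof. by rewrite ffunE spos_le. Qed.

Lemma reflects_vp p : reflects w (sp p) (vp p) p.
Proof.
move=> i; split; first exact: vp_le.
by rewrite !ffunE /spos -/n effK // -ltnS; exact: dig_lt.
Qed.

Lemma cnt_dir_up p : cnt_dir true (sp p) (seen w (vp p)) = sp p.+1.
Proof.
apply/ffunP => i; rewrite !ffunE (carry_up _ (reflects_vp p)) (at_ext_max _ (reflects_vp p)).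
rewrite -/n -/b -dvdn_exp_digS // /sdir -/b divS_exp // oddD oddb.
by case: (_ %| _); case: (odd _).
Qed.

Lemma cnt_dir_down p : cnt_dir false (sp p.+1) (seen w (vp p.+1)) = sp p.
Proof.
apply/ffunP => i; rewrite !ffunE (carry_down _ (reflects_vp _)) (at_ext_min _ (reflects_vp _)).
rewrite -/n -/b -dvdn_expS // /sdir -/b divS_exp // oddD oddb.
by case: (_ %| _); case: (odd _).
Qed.

Lemma cnt_move_work up s v (i : 'I_m) : v i <= n.+1 ->
  move_work (cnt_move up s (seen w v) i) (v i) = move_input n (cnt_move up s (seen w v) i) (v i).
Proof.
move=> Hv; rewrite ffunE; case: ifP => // /andP [_]; rewrite /at_ext ffunE.
by case: (up (+) s i) => //=; rewrite input_at_REnd -/n; lia.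
Qed.

Lemma cnt_move_up p :
  [ffun i => move_work (cnt_move true (sp p) (seen w (vp p)) i) (vp p i)] = vp p.+1.
Proof.
apply/ffunP => i; rewrite ffunE cnt_move_work ?vp_le //.
have [Hle] := reflects_up (reflects_vp p) i; rewrite cnt_dir_up [sp _ i]ffunE => He.
by rewrite [RHS]ffunE /spos -/b -He effK.
Qed.

Lemma cnt_move_down p :
  [ffun i => move_work (cnt_move false (sp p.+1) (seen w (vp p.+1)) i) (vp p.+1 i)] = vp p.
Proof.
apply/ffunP => i; rewrite ffunE cnt_move_work ?vp_le //.
have [Hle] := reflects_down (reflects_vp p.+1) i; rewrite cnt_dir_down [sp _ i]ffunE => He.
by rewrite [RHS]ffunE /spos -/b -He effK.
Qed.

Lemma right_end p : p < M -> all_ext true (sp p) (seen w (vp p)) = (p.+1 == M).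
Proof.
move=> Hp; rewrite (all_ext_max (reflects_vp p)) -/n -/b -/M.
by apply/idP/eqP => [/dvdn_leq H|->//]; apply/eqP; rewrite eqn_leq Hp H.
Qed.

Lemma left_end p : p < M -> all_ext false (sp p) (seen w (vp p)) = (p == 0).
Proof.
move=> Hp; rewrite (all_ext_zero (reflects_vp p)) -/n -/b -/M.
apply/idP/eqP => [|->]; last exact: dvdn0.
by case: p Hp => // p Hp /dvdn_leq; lia.
Qed.

Lemma low_max p : [forall i, at_ext true (sp p) (seen w (vp p)) (lshift d i)] = (N %| p.+1).
Proof.
rewrite /N dvdn_exp_lowS // (@all_iota_forall h) //; apply: eq_forallb => i.
by rewrite (at_ext_max _ (reflects_vp p)) ltn_ord.
Qed.

Lemma low_min p : [forall i, at_ext false (sp p) (seen w (vp p)) (lshift d i)] = (N %| p).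
Proof.
rewrite /N dvdn_exp_low // (@all_iota_forall h) //; apply: eq_forallb => i.
by rewrite (at_ext_min _ (reflects_vp p)) ltn_ord.
Qed.

Lemma dig_high p i : dig b p (h + i) = dig b (p %/ N) i.
Proof. by rewrite /dig expnD divnMA. Qed.

Lemma block_lt p : p < M -> p %/ N < K.+2.
Proof. by rewrite length_eq => Hp; rewrite ltn_divLR // expn_gt0. Qed.

Lemma high_max p : p < M ->
  [forall i, at_ext true (sp p) (seen w (vp p)) (rshift h i)] = (p %/ N == K.+1).
Proof.
move=> /block_lt Hp.
have -> : (p %/ N == K.+1) = (b ^ d %| (p %/ N).+1).
  rewrite blocks_eq; apply/eqP/idP => [->//|/dvdn_leq H].
  by apply/eqP; rewrite eqn_leq -ltnS Hp -ltnS H.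
rewrite dvdn_exp_lowS // (@all_iota_forall d) //; apply: eq_forallb => i.
by rewrite (at_ext_max _ (reflects_vp p)) ltn_ord -dig_high.
Qed.

Lemma high_min p : p < M ->
  [forall i, at_ext false (sp p) (seen w (vp p)) (rshift h i)] = (p %/ N == 0).
Proof.
move=> /block_lt Hp.
have -> : (p %/ N == 0) = (b ^ d %| p %/ N).
  rewrite blocks_eq; apply/eqP/idP => [->//|]; case: (p %/ N) Hp => // k Hk /dvdn_leq; lia.
rewrite dvdn_exp_low // (@all_iota_forall d) //; apply: eq_forallb => i.
by rewrite (at_ext_min _ (reflects_vp p)) ltn_ord -dig_high.
Qed.

Definition in_space (c : tm_conf machine) := forall j, tc_heads c j < M.
Definition steps (c c' : tm_conf machine) :=
  exists t, iter t (tm_step w) c = c' /\ forall s, s < t -> in_space (iter s (tm_step w) c).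

Lemma steps_refl c : steps c c.
Proof. by exists 0. Qed.

Lemma steps_trans c c' c'' : steps c c' -> steps c' c'' -> steps c c''.
Proof.
move=> [t [Et Ht]] [t' [Et' Ht']]; exists (t' + t); rewrite iterD Et; split=> // s Hs.
case: (ltnP s t) => [/Ht //|Hts].
by rewrite -(subnK Hts) iterD Et; apply: Ht'; lia.
Qed.

Lemma steps1 c c' c'' : in_space c -> tm_step w c = c' -> steps c' c'' -> steps c c''.
Proof.
move=> Hc <-; apply: steps_trans; exists 1; split=> // s.
by rewrite ltnS leqn0 => /eqP ->.
Qed.

Lemma in_space_cfg st v p X mk : (forall i, v i <= n.+1) -> p < M -> in_space (cfg st v p X mk).
Proof.
move=> Hv Hp j; rewrite ffunE; case: (unlift _ _) => // i; apply: leq_ltn_trans (Hv i) _.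
have : b ^ 1 <= M by rewrite leq_exp2l // /m; lia.
by rewrite expn1 /b.
Qed.

Definition cp c p X mk := cfg (inl (c, sp p)) (vp p) p X mk.

Lemma in_space_cp c p X mk : p < M -> in_space (cp c p X mk).
Proof. by move=> Hp; apply: in_space_cfg => // i; exact: vp_le. Qed.

Definition mk0 : 'I_m -> nat -> bool * bool := fun _ _ => (false, false).

Lemma move_stay v : [ffun i => move_work ([ffun=> Stay] i) (v i)] = v :> {ffun 'I_m -> nat}.
Proof. by apply/ffunP => i; rewrite !ffunE. Qed.

Lemma mk_same v mk : (fun i y => if y == v i then [ffun i => mk i (v i)] i else mk i y) = mk
  :> ('I_m -> nat -> bool * bool).
Proof.
apply: functional_extensionality => i; apply: functional_extensionality => y.
by rewrite ffunE; case: eqP => // ->.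
Qed.

Definition zeroed X p : nat -> cell := fun q => if p <= q < M then c0 else X q.

(** The flag [z] is false only at the starting cell, whose letter has just been set and must be
    kept. *)
Lemma zero_steps z p X : p < M ->
  steps (cp (Zero z) p X mk0) (cp Tail M.-1 (zeroed X (p + ~~ z)) mk0).
Proof.
move=> Hp; have [k Hk] := ubnP (M - p); elim: k p z X Hp Hk => // k IH p z X Hp Hk.
apply: steps1 (in_space_cp _ _ _ Hp) (erefl _) _.
have := @step_post (Zero z) (sp p) (vp p) p X mk0; rewrite /post (right_end Hp).
case: eqP => Hr.
  rewrite move_stay mk_same /= => ->.
  have -> : M.-1 = p by lia.
  rewrite -/(cp _ p _ _); suff -> : upd X p (if z then c0 else X p) = zeroed X (p + ~~ z).
    exact: steps_refl.
  apply: functional_extensionality => q; rewrite /upd /zeroed.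
  by case: z => /=; case: (q =P p) => Hq; rewrite ?Hq; case: ifP => //; lia.
rewrite cnt_dir_up cnt_move_up mk_same /= => ->.
rewrite -/(cp _ p.+1 _ _).
suff -> : zeroed X (p + ~~ z) =
    zeroed (upd X p (if z then c0 else X p)) (p.+1 + ~~ true) by apply: IH; lia.
apply: functional_extensionality => q; rewrite /upd /zeroed.
by case: z => /=; case: (q =P p) => Hq; rewrite ?Hq; case: ifP => //; case: ifP => //; lia.
Qed.

Section ScanFold.
Variables (X : nat -> cell) (g g2 : grid h w).

Definition scan_at (p : nat) (D : sdata) : sdata :=
  scan_upd (p %/ N == K.+1) (p %/ N == 0) (N %| p.+1) (gvec h w p == g) (gvec h w p == g2) D (X p).

Fixpoint scan_fold (D : sdata) (p : nat) : sdata :=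
  let D' := scan_at p D in if p is p'.+1 then scan_fold D' p' else D'.

Lemma scan_foldE D p : 0 < p -> scan_fold D p = scan_fold (scan_at p D) p.-1.
Proof. by case: p. Qed.

Let N0 : 0 < N.
Proof. by rewrite expn_gt0. Qed.

Lemma block_pred k : (k.+1 * N).-1 = k * N + N.-1.
Proof. by have := N0; rewrite mulSn; lia. Qed.

Lemma block_div k c : c < N -> (k * N + c) %/ N = k.
Proof. by move=> Hc; rewrite divnMDl // divn_small // addn0. Qed.

Lemma block_dvd k c : c < N -> (N %| (k * N + c).+1) = (c.+1 == N).
Proof.
move=> Hc; rewrite -addnS dvdn_addr ?dvdn_mull //.
by apply/idP/eqP => [/dvdn_leq H|->//]; apply/eqP; rewrite eqn_leq Hc H.
Qed.

Lemma block_gvec k c g' : c < N -> (gvec h w (k * N + c) == g') = (gpos k g' == k * N + c).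
Proof.
move=> Hc; apply/eqP/eqP => [<-|<-]; last by case: (gposP k g').
by rewrite -{1}(block_div k Hc) gposK.
Qed.

Lemma scan_fold_last c x bt ab ss : c < N ->
  scan_fold (x, bt, ab, ss) (K.+1 * N + c) = scan_fold (symb w K X, bt, ab, ss) (K.+1 * N).-1.
Proof.
have H0 : 0 < K.+1 * N by rewrite muln_gt0.
case: ab ss => [a b'] [s1 s2].
have step c' D : c' < N -> scan_at (K.+1 * N + c') D =
  (let: (_, bt, ab, ss) := D in ((X (K.+1 * N + c')).1.2, bt, ab, ss)).
  by move=> Hc'; rewrite /scan_at block_div // eqxx; case: D => [[[? ?] [? ?]] [? ?]].
elim: c x => [|c IH] x Hc.
  have E1 := step 0 (x, bt, (a, b'), (s1, s2)) N0; rewrite addn0 in E1.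
  by rewrite addn0 scan_foldE // E1.
by rewrite scan_foldE ?addnS // -addnS step // addnS /= IH // ltnW.
Qed.

(** Stated for a start at any offset [c] in the block, for the induction: the bit is read only when
    the right end is included, and [gpos k g <= k * N + c] says that the wanted cell is still
    ahead. *)
Lemma scan_fold_mid k c x bt a b' ss : 0 < k <= K -> c < N ->
  let bt' := if c.+1 == N then bit w X k else bt in
  scan_fold (x, bt, (a, b'), ss) (k * N + c) =
  scan_fold (x, bt', (if [&& bt', a == None & gpos k g <= k * N + c] then Some (label w X k g) else a,
     if [&& ~~ bt', b' == None & gpos k g2 <= k * N + c] then Some (label w X k g2) else b'), ss)
    (k * N).-1.
Proof.
case/andP => Hk0 HkK.
have H0 : 0 < k * N by rewrite muln_gt0 Hk0.
have step c' D : c' < N -> scan_at (k * N + c') D =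
  scan_upd false false (c'.+1 == N) (gpos k g == k * N + c') (gpos k g2 == k * N + c') D (X (k * N + c')).
  by move=> Hc'; rewrite /scan_at block_div // block_dvd // !block_gvec // (ltn_eqF (HkK : k < K.+1)) (gtn_eqF Hk0).
have lab (g' : grid h w) c' : gpos k g' = k * N + c' -> (X (k * N + c')).1.1 = label w X k g'.
  by move=> <-; rewrite ffunE.
have lab' c' : c'.+1 = N -> ((X (k * N + c')).2 != None) = bit w X k.
  by move=> E'; rewrite /bit -/n -/b -/N (_ : N.-1 = c') // -E'.
have ge (g' : grid h w) : k * N <= gpos k g' by have /andP [-> _] := gpos_range k g'.
elim: c bt a b' => [|c IH] bt a b' Hc /=.
  rewrite scan_foldE ?addn0 // -{1}(addn0 (k * N)) step // /scan_upd; case: ss => s1 s2 /=.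
  rewrite !addn0 -(addn0 (k * N)).
  have le1 (g' : grid h w) : (gpos k g' == k * N + 0) = (gpos k g' <= k * N + 0) by rewrite eqn_leq addn0 ge andbT.
  have -> : (if 1 == N then (X (k * N + 0)).2 != None else bt) = (if 1 == N then bit w X k else bt).
    by case: eqP => // /lab' ->.
  rewrite !orbF !le1; congr (scan_fold (_, (_, _), _) _).
    case: leqP => Hg; rewrite ?andbF //= andbT.
    by case: ifP => //; rewrite (lab g) //; apply/eqP; rewrite le1.
  case: leqP => Hg; rewrite ?andbF //= andbT.
  by case: ifP => //; rewrite (lab g2) //; apply/eqP; rewrite le1.
rewrite scan_foldE; last by rewrite addnS.
rewrite step // (_ : (k * N + c.+1).-1 = k * N + c); last by rewrite addnS.
rewrite /scan_upd; case: ss IH => s1 s2 IH /=.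
have -> : (if c.+2 == N then (X (k * N + c.+1)).2 != None else bt) = (if c.+2 == N then bit w X k else bt).
  by case: eqP => // /lab' ->.
set bt' := if c.+2 == N then _ else bt.
rewrite IH; last exact: ltnW.
rewrite (ltn_eqF Hc) !orbF /=; congr (scan_fold (_, (_, _), _) _).
  rewrite [gpos k g <= k * N + c.+1]leq_eqVlt addnS ltnS.
  case: (gpos k g =P _) => [/[dup] Eg ->|_] /=; last by [].
  rewrite -addnS in Eg; rewrite -addnS (lab _ _ Eg) -Eg.
  by case: bt'; case: a.
rewrite [gpos k g2 <= k * N + c.+1]leq_eqVlt addnS ltnS.
case: (gpos k g2 =P _) => [/[dup] Eg ->|_] /=; last by [].
rewrite -addnS in Eg; rewrite -addnS (lab _ _ Eg) -Eg.
by case: bt'; case: b'.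
Qed.

Lemma scan_fold_first c x bt a b' s1 s2 : c < N -> exists bt',
  scan_fold (x, bt, (a, b'), (s1, s2)) c =
  (x, bt', (if (a == None) && (gpos 0 g <= c) then Some (label w X 0 g) else a, b'),
   (if gpos 0 g <= c then label w X 0 g else s1, if gpos 0 g2 <= c then label w X 0 g2 else s2)).
Proof.
have step c' D : c' < N -> scan_at c' D =
  scan_upd false true (c'.+1 == N) (gpos 0 g == c') (gpos 0 g2 == c') D (X c').
  move=> Hc'; have := block_div 0 Hc'; have := block_dvd 0 Hc'.
  have := block_gvec 0 g Hc'; have := block_gvec 0 g2 Hc'; rewrite mul0n add0n.
  by move=> E1 E2 E3 E4; rewrite /scan_at E1 E2 E3 E4.
have lab (g' : grid h w) c' : gpos 0 g' = c' -> (X c').1.1 = label w X 0 g' by move=> <-; rewrite ffunE.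
elim: c bt a s1 s2 => [|c IH] bt a s1 s2 Hc.
  rewrite -[scan_fold _ 0]/(scan_at 0 _) step // /scan_upd !leqn0 orbT /=.
  set bt' := if 1 == N then _ else bt; exists bt'; rewrite !andbF.
  congr (_, (_, _), (_, _)).
  - by case: eqP => [/lab ->|]; rewrite ?andbT ?andbF.
  - by case: eqP => [/lab ->|].
  - by case: eqP => [/lab ->|].
have [bt'' E1] := IH (if c.+2 == N then (X c.+1).2 != None else bt)
  (if (gpos 0 g == c.+1) && (a == None) then Some (X c.+1).1.1 else a)
  (if gpos 0 g == c.+1 then (X c.+1).1.1 else s1) (if gpos 0 g2 == c.+1 then (X c.+1).1.1 else s2) (ltnW Hc).
exists bt''; rewrite (@scan_foldE _ c.+1) // step // /scan_upd /= orbT !andbF /= E1.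
have leS (g' : grid h w) : (gpos 0 g' <= c.+1) = (gpos 0 g' == c.+1) || (gpos 0 g' <= c).
  by rewrite leq_eqVlt ltnS.
rewrite !leS; congr (_, (_, _), (_, _)).
- case: (gpos 0 g =P _) => [Eg|_] //=; rewrite (lab _ _ Eg) Eg ltnn andbF andbT.
  by case: (a).
- by case: (gpos 0 g =P _) => [Eg|_] //=; rewrite (lab _ _ Eg); case: ifP.
- by case: (gpos 0 g2 =P _) => [Eg|_] //=; rewrite (lab _ _ Eg); case: ifP.
Qed.

(** An endpoint found in a block further right is kept, hence [ends] enters only as the default of
    [odflt]. *)
Lemma scan_fold_blocks k x bt a b' s1 s2 : k <= K -> exists bt' a' b'',
  [/\ scan_fold (x, bt, (a, b'), (s1, s2)) (k * N + N.-1) =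
      (x, bt', (a', b''), (label w X 0 g, label w X 0 g2)),
      odflt set0 a' = odflt ((ends w X k).1 g) a &
      odflt set0 b'' = odflt ((ends w X k).2 g2) b'].
Proof.
have HN : N.-1 < N by rewrite prednK.
have Hle j (g' : grid h w) : gpos j g' <= j * N + N.-1.
  by have /andP [_] := gpos_range j g'; rewrite mulSn -/n -/b -/N; lia.
elim: k bt a b' => [|k IH] bt a b' Hk.
  have [bt' ->] := @scan_fold_first N.-1 x bt a b' s1 s2 HN.
  have := Hle 0 g; have := Hle 0 g2; rewrite mul0n add0n => -> ->.
  exists bt', (if (a == None) && true then Some (label w X 0 g) else a), b'; split=> //.
    by case: a.
  by case: b' => //=; rewrite ffunE.
rewrite (@scan_fold_mid k.+1 N.-1) // prednK // eqxx !Hle !andbT.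
rewrite block_pred.
set a1 := if _ then _ else a; set b1 := if _ then _ else b'.
have [bt' [a' [b'' [-> Ea Eb]]]] := IH (bit w X k.+1) a1 b1 (ltnW Hk).
exists bt', a', b''; split=> //; rewrite ?Ea ?Eb /a1 /b1 /=;
  by case: (bit w X k.+1); case: (a); case: (b').
Qed.

Lemma scan_fold_leaf c ch : c < N ->
  scan_check ch (scan_fold (x0, false, (None, None), (set0, set0)) (K.+1 * N + c)) =
  let: (y, one, ms) := ch in
  check y one ms (symb w K X) ((ends w X K).1 g) ((ends w X K).2 g2)
    (label w X 0 g) (label w X 0 g2).
Proof.
move=> Hc; rewrite scan_fold_last //.
rewrite block_pred.
have [bt' [a' [b'' [-> Ea Eb]]]] :=
  @scan_fold_blocks K (symb w K X) false None None set0 set0 (leqnn K).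
by case: ch => [[y one] ms] /=; rewrite Ea Eb.
Qed.
End ScanFold.

Lemma low_lshift (T : Type) (f : 'I_h -> T) t i : low f t (lshift d i) = f i.
Proof. by rewrite /low (unsplitK (inl i)). Qed.

Lemma low_rshift (T : Type) (f : 'I_h -> T) t i : low f t (rshift h i) = t.
Proof. by rewrite /low (unsplitK (inr i)). Qed.

Lemma vp_lshift p i : vp p (lshift d i) = gvec h w p i.
Proof. by rewrite ffunE gvecE. Qed.

(** Each coordinate of a point is marked on its own digit tape; the scan is at the point exactly
    when the low [h] heads all see the mark. *)
Definition chmark (p : nat) (ms : {ffun 'I_h -> move}) : 'I_m -> nat -> bool * bool :=
  fun i y => low (fun j => (y == gvec h w p j, y == gmove ms (gvec h w p) j)) (false, false) i.

Lemma chmark1 p q ms :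
  [forall i, ([ffun i => chmark q ms i (vp p i)] (lshift d i)).1] = (gvec h w p == gvec h w q).
Proof.
apply/forallP/eqP => [H|H i]; last by rewrite ffunE /chmark low_lshift vp_lshift H eqxx.
apply/ffunP => i; apply: val_inj; have := H i.
by rewrite ffunE /chmark low_lshift vp_lshift => /eqP.
Qed.

Lemma chmark2 p q ms :
  [forall i, ([ffun i => chmark q ms i (vp p i)] (lshift d i)).2]
  = (gvec h w p == gmove ms (gvec h w q)).
Proof.
apply/forallP/eqP => [H|H i]; last by rewrite ffunE /chmark low_lshift vp_lshift H eqxx.
apply/ffunP => i; apply: val_inj; have := H i.
by rewrite ffunE /chmark low_lshift vp_lshift => /eqP.
Qed.

Definition scan0 : sdata := (x0, false, (None, None), (set0, set0)).
Definition chal_at (p : nat) (ms : {ffun 'I_h -> move}) : chal :=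
  (gsyms (gvec h w p), gvec h w p == grid1 h w, ms).

(** One step marks the point and moves the low digit heads to its successor, the next marks that and
    undoes the moves. The symbols remembered in the challenge tell which moves were cut off and must
    not be undone. *)
Lemma mark_steps p ms X : p < M -> (X p).2 = Some ms ->
  steps (cp Tail p X mk0) (cp (Scan (chal_at p ms) scan0) p X (chmark p ms)).
Proof.
move=> Hp HX; apply: steps1 (in_space_cp _ _ _ Hp) (erefl _) _.
have := @step_post Tail (sp p) (vp p) p X mk0; rewrite /post HX => ->.
rewrite upd_id.
have -> : ([ffun i => [ffun i => input_at w (vp p i)] (lshift d i)],
           [forall i, [ffun i => vp p i == 1] (lshift d i)], ms) = chal_at p ms.
  congr (_, _, _); first by apply/ffunP => i; rewrite ffunE ffunE vp_lshift [RHS]ffunE.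
  apply/forallP/eqP => [H|H i]; last by rewrite ffunE vp_lshift H ffunE inordK.
  apply/ffunP => i; apply: val_inj; have := H i.
  by rewrite ffunE vp_lshift => /eqP E1; rewrite /= E1 ffunE inordK.
set v' := [ffun i => move_work _ _]; set mk' := (Z in cfg _ _ _ _ Z).
have Ev i : v' i = low (fun j => move_input n (ms j) (vp p i)) (vp p i) i.
  rewrite /v' ffunE ffunE; case: (split_ordP i) => j ->; rewrite ?low_rshift // !low_lshift.
  by rewrite ffunE move_clamp ?vp_le.
have Hv' i : v' i <= n.+1 /\
    move_work (low (fun j => opp_move (clamp (ms j) (gsyms (gvec h w p) j))) Stay i) (v' i) = vp p i.
  rewrite Ev; case: (split_ordP i) => j ->; rewrite ?low_rshift ?low_lshift; last by rewrite vp_le.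
  rewrite [gsyms _ _]ffunE -vp_lshift move_opp_clamp ?vp_le //.
  by split=> //; apply: move_input_le; exact: vp_le.
apply: steps1 (in_space_cfg _ _ _ _ Hp) (erefl _) _; first by move=> i; case: (Hv' i).
have := @step_post (Mark2 (chal_at p ms)) (sp p) v' p X mk'; rewrite /post => ->.
rewrite upd_id /= (_ : [ffun i => move_work _ _] = vp p); last first.
  by apply/ffunP => i; rewrite ffunE ffunE; case: (Hv' i).
set mk2 := (Z in cfg _ _ _ _ Z); rewrite -/(cp _ p X mk2).
suff -> : mk2 = chmark p ms by exact: steps_refl.
apply: functional_extensionality => i; apply: functional_extensionality => y.
rewrite /mk2 /chmark; case: (split_ordP i) => j ->; last first.
  have E1 z : mk' (rshift h j) z = (false, false).
    by rewrite /mk'; case: ifP => // _; rewrite ffunE low_rshift ffunE.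
  by rewrite low_rshift; case: ifP => _; rewrite ?E1 // ffunE low_rshift ffunE E1.
rewrite low_lshift -vp_lshift.
have -> : gmove ms (gvec h w p) j = v' (lshift d j) :> nat.
  rewrite Ev low_lshift ffunE inordK -vp_lshift //.
  by rewrite ltnS; apply: move_input_le; exact: vp_le.
have E1 z : mk' (lshift d j) z = (z == vp p (lshift d j), false).
  by rewrite /mk'; case: ifP => // _; rewrite ffunE low_lshift.
by case: (y =P v' _) => [->|_]; rewrite ?E1 // ffunE low_lshift ffunE E1.
Qed.

Lemma tail_steps c X : c < N ->
  steps (cp Tail (K.+1 * N + c) X mk0)
    (if challenge w K X c.+1 is Some (p, ms)
     then cp (Scan (chal_at p ms) scan0) p X (chmark p ms)
     else cp (Back true) (K.+1 * N) X mk0).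
Proof.
have HM c' : c' < N -> K.+1 * N + c' < M by rewrite length_eq [K.+2 * N]mulSn; lia.
elim: c => [|c IH] Hc; rewrite [challenge _ _ _ _]/=;
  case EX: (X _).2 => [ms|]; try by apply: mark_steps EX; exact: HM.
  rewrite addn0 in EX *; have Hp := HM 0 Hc; rewrite addn0 in Hp.
  apply: steps1 (in_space_cp _ _ _ Hp) (erefl _) _.
  have := @step_post Tail (sp (K.+1 * N)) (vp (K.+1 * N)) (K.+1 * N) X mk0.
  by rewrite /post EX low_min dvdn_mull // move_stay mk_same upd_id /= => ->; exact: steps_refl.
have Hp := HM _ Hc; apply: steps1 (in_space_cp _ _ _ Hp) (erefl _) _.
have := @step_post Tail (sp (K.+1 * N + c.+1)) (vp (K.+1 * N + c.+1)) (K.+1 * N + c.+1) X mk0.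
rewrite /post EX low_min dvdn_addr ?dvdn_mull // gtnNdvd //.
rewrite addnS cnt_dir_down cnt_move_down mk_same upd_id /= => ->.
by apply: IH; exact: ltnW.
Qed.

Lemma scan_steps p q ms ch D X : p < M ->
  steps (cp (Scan ch D) p X (chmark q ms))
    (cp (Back (scan_check ch (scan_fold X (gvec h w q) (gmove ms (gvec h w q)) D p)))
       0 X (chmark q ms)).
Proof.
elim: p D => [|p IH] D Hp; apply: steps1 (in_space_cp _ _ _ Hp) (erefl _) _.
  have := @step_post (Scan ch D) (sp 0) (vp 0) 0 X (chmark q ms).
  rewrite /post (left_end Hp) eqxx (high_max Hp) (high_min Hp) low_max chmark1 chmark2.
  by rewrite move_stay mk_same upd_id /= => ->; exact: steps_refl.
have := @step_post (Scan ch D) (sp p.+1) (vp p.+1) p.+1 X (chmark q ms).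
rewrite /post (left_end Hp) (high_max Hp) (high_min Hp) low_max chmark1 chmark2.
case: (p.+1 =P 0) => // _; rewrite cnt_dir_down cnt_move_down mk_same upd_id => ->.
by apply: IH; exact: ltnW.
Qed.

(** The run to the right end erases whatever lies under the digit heads; the hypothesis says that
    every remaining mark will still be visited. *)
Lemma back_steps (r : bool) p X mk : p < M ->
  (forall i y, mk i y != (false, false) -> exists2 q, p <= q < M & vp q i = y) ->
  steps (cp (Back r) p X mk) (cp (Odo r) M.-1 X mk0).
Proof.
move=> Hp; have [k Hk] := ubnP (M - p); elim: k p mk Hp Hk => // k IH p mk Hp Hk Hmk.
apply: steps1 (in_space_cp _ _ _ Hp) (erefl _) _.
have := @step_post (Back r) (sp p) (vp p) p X mk; rewrite /post (right_end Hp).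
case: eqP => Hr.
  rewrite move_stay upd_id /= => ->; have -> : M.-1 = p by lia.
  set mk' := (Z in cfg _ _ _ _ Z); rewrite -/(cp _ p _ mk'); suff -> : mk' = mk0 by exact: steps_refl.
  apply: functional_extensionality => i; apply: functional_extensionality => y.
  rewrite /mk'; case: (y =P _) => [_|Hy]; first by rewrite ffunE.
  apply/eqP; apply: contraT => Hm; have [q Hq Eq] := Hmk _ _ Hm.
  by case: Hy; rewrite -Eq; congr (vp _ _); lia.
rewrite cnt_dir_up cnt_move_up upd_id /= => ->; apply: IH; try lia.
move=> i y; case: (y =P _) => [_|Hy Hm]; first by rewrite ffunE.
have [q Hq Eq] := Hmk _ _ Hm; exists q => //.
have : q <> p by move=> E1; apply: Hy; rewrite -Eq E1.
by lia.
Qed.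

Lemma leaf_steps X : steps (cp Tail M.-1 X mk0) (cp (Odo (leaf w K X)) M.-1 X mk0).
Proof.
have N0 : 0 < N by rewrite expn_gt0.
have EM : M.-1 = K.+1 * N + N.-1 by rewrite length_eq block_pred.
have HN : N.-1 < N by rewrite prednK.
have M0 : 0 < M by rewrite expn_gt0.
have := tail_steps X HN; rewrite prednK // -EM => /steps_trans; apply.
rewrite /leaf -/n -/b -/N.
case Ec: (challenge w K X N) => [[p ms]|]; last first.
  by apply: back_steps => //; rewrite length_eq [K.+2 * N]mulSn; lia.
have [c Hc Ep] : exists2 c, c < N & p = K.+1 * N + c.
  have gen c' : c' <= N -> challenge w K X c' = Some (p, ms) ->
      exists2 c, c < N & p = K.+1 * N + c; last exact: gen Ec.
  elim: c' => // c IH Hc /=; case: (X _).2 => [ms'|]; last by apply: IH; exact: ltnW.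
  by case=> <- _; exists c.
have Hp : p < M by rewrite Ep length_eq [K.+2 * N]mulSn; lia.
apply: steps_trans (scan_steps _ _ _ _ _ Hp) _.
rewrite {4}Ep scan_fold_leaf //.
apply: back_steps => // i y Hy.
have Hy' : y <= n.+1.
  move: Hy; rewrite /chmark; case: (split_ordP i) => j ->; rewrite ?low_rshift // low_lshift.
  case: (y =P nat_of_ord (gvec h w p j)) => [-> _|_]; first by rewrite -ltnS.
  by case: (y =P nat_of_ord (gmove _ _ _)) => [-> _|//]; rewrite -ltnS.
(* The position at which all digit heads stand on [y]: it belongs to the word, so the run from the
   left end meets the mark. *)
have [E1 E2] := @unsposP n m 0 (fun=> y) (fun _ _ => Hy').
exists (unspos n m 0 (fun=> y)); last by rewrite ffunE E2.
by rewrite /= -(mul1n M) -ltn_divLR // E1.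
Qed.

Definition exit_conf (r : bool) (p : nat) X : tm_conf machine :=
  if p is p'.+1 then cp (Odo r) p' X mk0 else cfg (inr r) (vp 0) 0 X mk0.

(** [r] is the value of the game after cell [p]. If it is true, the next universal letter must be
    tried; if false, the next existential letter, starting again from [u0]. When no such letter is
    left, [r] is also the value of the choice at [p] and is carried to the left. *)
Lemma odo_steps r p X e u : p < M -> X p = (e, u) ->
  steps (cp (Odo r) p X mk0)
    (match (if r then omap (pair e) (next_elt u) else omap (fun e' => (e', u0)) (next_elt e)) with
     | Some x => cp Tail M.-1 (zeroed (upd X p x) p.+1) mk0
     | None => exit_conf r p X
     end).
Proof.
move=> Hp HX; apply: steps1 (in_space_cp _ _ _ Hp) (erefl _) _.
have := @step_post (Odo r) (sp p) (vp p) p X mk0; rewrite /post HX /=.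
have incr x : tm_step w (cp (Odo r) p X mk0) = cp (Zero false) p (upd X p x) mk0 ->
  steps (tm_step w (cp (Odo r) p X mk0)) (cp Tail M.-1 (zeroed (upd X p x) p.+1) mk0).
  by move=> ->; rewrite -addn1; exact: zero_steps.
have left : tm_step w (cp (Odo r) p X mk0) = exit_conf r p X ->
  steps (tm_step w (cp (Odo r) p X mk0)) (exit_conf r p X).
  by move=> ->; exact: steps_refl.
case: r incr left => incr left.
  case: (next_elt u) => [u'|] /=; rewrite ?move_stay ?mk_same; first exact: incr.
  rewrite (left_end Hp) => Es; apply: left; case: p Hp HX incr Es => [|p] Hp HX _ /=.
    by rewrite move_stay mk_same -HX upd_id.
  by rewrite cnt_dir_down cnt_move_down mk_same -HX upd_id.
case: (next_elt e) => [e'|] /=; rewrite ?move_stay ?mk_same; first exact: incr.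
rewrite (left_end Hp) => Es; apply: left; case: p Hp HX incr Es => [|p] Hp HX _ /=.
  by rewrite move_stay mk_same -HX upd_id.
by rewrite cnt_dir_down cnt_move_down mk_same -HX upd_id.
Qed.

Lemma has_enum (T : finType) (P : pred T) : has P (enum T) = [exists x, P x].
Proof.
apply/hasP/existsP => [[x _ Hx]|[x Hx]]; first by exists x.
by exists x; rewrite ?mem_enum.
Qed.

Lemma all_enum (T : finType) (P : pred T) : all P (enum T) = [forall x, P x].
Proof.
by apply/allP/forallP => [H x|H x _]; [apply: H; rewrite mem_enum|exact: H].
Qed.

(** Induction on the number [k] of open cells: each choice at the first of them starts an evaluation
    of the remaining ones, which must begin with first letters. *)
Lemma play_steps k X : k <= M -> (forall q, M - k <= q < M -> X q = c0) ->
  exists2 X', agree_out X X' (M - k) k &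
    steps (cp Tail M.-1 X mk0) (exit_conf (play k (leaf w K) X (M - k)) (M - k) X').
Proof.
have M0 : 0 < M by rewrite expn_gt0.
elim: k X => [|k IH] X0 Hk HX0.
  by exists X0 => //; rewrite subn0 /exit_conf -{2}(prednK M0); exact: leaf_steps.
set p := M - k.+1; have Ep : M - k = p.+1 by rewrite /p; lia.
have Hp : p < M by rewrite /p; lia.
pose F e u := play k (leaf w K) (upd X0 p (e, u)) p.+1.
have EE : enum E = e0 :: later e0 := enum_first _.
have EU : enum U = u0 :: later u0 := enum_first _.
(* The value still to be determined when [(e, u)] is current: [e] may win on the universal letters
   from [u] on, or some later [e] on all of them. The weight [#|U|.+1] makes the measure drop when
   [e] advances and [u] starts over. *)
suff gen s e u X : size (later e) * #|U|.+1 + size (later u) < s -> X p = (e, u) ->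
    agree_out X0 X p k.+1 -> (forall q, p < q < M -> X q = c0) ->
    exists2 X', agree_out X0 X' p k.+1 & steps (cp Tail M.-1 X mk0)
      (exit_conf (all (F e) (u :: later u) || has (fun e => all (F e) (enum U)) (later e)) p X').
  have [|||X' H1 H2] := gen _ e0 u0 X0 (ltnSn _) => //.
  - by rewrite HX0 // -/p leqnn.
  - by move=> q Hq; rewrite HX0 // -/p; lia.
  exists X' => //.
  have -> : play k.+1 (leaf w K) X0 p = has (fun e => all (F e) (enum U)) (enum E).
    by rewrite has_enum /=; apply: eq_existsb => e; rewrite all_enum.
  by rewrite EE /= {1}EU.
elim: s e u X => // s IHs e u X Hs HX Hag Hz.
have EF : play k (leaf w K) X p.+1 = F e u.
  apply: play_ext => q Hq; rewrite /upd; case: eqP => [->//|Hqp].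
  by rewrite Hag //; lia.
have [||X1 Hag1 Hst] := IH X; [lia| |].
  by move=> q; rewrite Ep => Hq; apply: Hz; lia.
rewrite Ep EF /= in Hst Hag1.
have HX1 : X1 p = (e, u) by rewrite Hag1 ?HX //; lia.
have Hag' : agree_out X0 X1 p k.+1.
  by move=> q Hq; rewrite Hag1; [apply: Hag|]; lia.
have Hnext x : agree_out X0 (zeroed (upd X1 p x) p.+1) p k.+1 /\
    forall q, p < q < M -> zeroed (upd X1 p x) p.+1 q = c0.
  split=> q Hq; rewrite /zeroed; last by rewrite Hq.
  have -> : (p < q < M) = false by rewrite /p in Hq *; lia.
  by rewrite /upd ifN; [apply: Hag'|]; lia.
have Hnp x : zeroed (upd X1 p x) p.+1 p = x by rewrite /zeroed ltnn /= /upd eqxx.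
have := odo_steps (F e u) Hp HX1.
have lateU (u' : U) : size (later u') <= #|U| by rewrite /later size_drop -cardE leq_subr.
case Efu : (F e u) Hst => Hst /=.
  case En : (next_elt u) => [u'|] /= Hodo.
    have El : later u = u' :: later u' by rewrite (later_next None u) En.
    have [||||X' H1 H2] := IHs e u' (zeroed (upd X1 p (e, u')) p.+1); rewrite ?Hnp //.
    - by move: Hs; rewrite El /=; lia.
    - by case: (Hnext (e, u')).
    - by case: (Hnext (e, u')).
    exists X' => //; apply: steps_trans Hst (steps_trans Hodo _).
    by move: H2; rewrite El /= Efu.
  exists X1 => //; rewrite (later_next None u) En /= Efu.
  exact: steps_trans Hst Hodo.
case En : (next_elt e) => [e'|] /= Hodo; last first.
  by exists X1 => //; rewrite (later_next (set0, x0) e) En /= Efu; exact: steps_trans Hst Hodo.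
have El : later e = e' :: later e' by rewrite (later_next (set0, x0) e) En.
have [||||X' H1 H2] := IHs e' u0 (zeroed (upd X1 p (e', u0)) p.+1); rewrite ?Hnp //.
- move: Hs (lateU u0); rewrite El /= mulSn; move: (size (later e') * _) (size (later u0)) => a c.
  by move: #|U| => cU; lia.
- by case: (Hnext (e', u0)).
- by case: (Hnext (e', u0)).
exists X' => //; apply: steps_trans Hst (steps_trans Hodo _).
by move: H2; rewrite El /= Efu EU.
Qed.

Definition copy_conf (st : option bool) (c i : nat) : tm_conf machine :=
  @TmConf _ _ machine (inl st) i (heads [ffun=> c] 0)
    (fun j y => match unlift ord0 j with
                | Some _ => if y < c then (input_at w y, y == 1, (false, false), c0) else (dblank, c0)
                | None => (dblank, c0)
                end).

Lemma in_space_copy st c i : c <= n.+1 -> in_space (copy_conf st c i).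
Proof.
move=> Hc j; rewrite /= ffunE; case: (unlift _ _) => [j'|]; last by rewrite expn_gt0.
rewrite ffunE; apply: leq_ltn_trans Hc _.
have : b ^ 1 <= M by rewrite leq_exp2l // /m; lia.
by rewrite expn1 /b.
Qed.

Lemma copy_conf0 : tm_conf0 machine = copy_conf None 0 1.
Proof.
rewrite /tm_conf0 /copy_conf; congr TmConf.
  by apply/ffunP => j; rewrite !ffunE; case: (unlift _ _) => [j'|]; rewrite ?ffunE.
apply: functional_extensionality => j; apply: functional_extensionality => y.
by case: (unlift _ _).
Qed.

Lemma copy_step0 : tm_step w (copy_conf None 0 1) = copy_conf (Some true) 1 1.
Proof.
rewrite /tm_step /=; congr TmConf.
  by apply/ffunP => j; rewrite !ffunE; case: (unlift _ _) => [j'|]; rewrite ?ffunE.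
apply: functional_extensionality => j; apply: functional_extensionality => y.
rewrite !ffunE unlift_none; case: (unlift _ _) => [j'|]; rewrite ?ffunE //; last by case: eqP.
by case: y.
Qed.

Lemma copy_step c : 0 < c <= n ->
  tm_step w (copy_conf (Some (c == 1)) c c) = copy_conf (Some false) c.+1 c.+1.
Proof.
move=> Hc; rewrite /tm_step /= input_at_REnd -/n ltnNge (_ : c <= n) /=; last by case/andP: Hc.
congr TmConf; first by rewrite -/n /=; lia.
  by apply/ffunP => j; rewrite !ffunE; case: (unlift _ _) => [j'|]; rewrite ?ffunE.
apply: functional_extensionality => j; apply: functional_extensionality => y.
rewrite !ffunE unlift_none; case: (unlift _ _) => [j'|]; rewrite ?ffunE //; last by case: eqP.
by rewrite [y < c.+1]ltnS [y <= c]leq_eqVlt; case: (y =P c) => [->|].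
Qed.

Lemma copy_step_last :
  tm_step w (copy_conf (Some (n.+1 == 1)) n.+1 n.+1) = cp (Zero false) 0 (fun=> c0) mk0.
Proof.
rewrite /tm_step /= input_at_REnd -/n leqnn /= /cp /cfg; congr TmConf.
- by congr (inr (inl (_, _))); apply/ffunP => i; rewrite !ffunE /sdir div0n.
- apply/ffunP => j; rewrite !ffunE; case: (unlift _ _) => [j'|]; rewrite ?ffunE //=.
  by rewrite /spos /sdir /dig !div0n mod0n.
- apply: functional_extensionality => j; apply: functional_extensionality => y.
  rewrite /tapes !ffunE unlift_none; case: (unlift _ _) => [j'|]; rewrite ?ffunE //; last by case: eqP.
  case: (y =P n.+1) => [->|Hy].
    by rewrite (eqP (_ : input_at w n.+1 == REnd)) // input_at_REnd.
  case: ltnP => // Hy'; rewrite /mk0 (eqP (_ : input_at w y == REnd)); last by rewrite input_at_REnd -/n; lia.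
  by rewrite (_ : (y == 1) = false) //; lia.
Qed.

Lemma copy_steps c : 0 < c <= n.+1 ->
  steps (copy_conf (Some (c == 1)) c c) (cp (Zero false) 0 (fun=> c0) mk0).
Proof.
move=> Hc; have [k Hk] := ubnP (n.+1 - c); elim: k c Hc Hk => // k IH c Hc Hk.
have Hs : in_space (copy_conf (Some (c == 1)) c c) by apply: in_space_copy; lia.
case: (eqVneq c n.+1) => [Ec|Hn].
  by apply: (steps1 Hs) (steps_refl _); rewrite Ec copy_step_last.
have Hc' : 0 < c <= n by lia.
apply: (steps1 Hs (copy_step Hc')).
have E1 : (c.+1 == 1) = false by lia.
by have := IH c.+1; rewrite E1; apply; lia.
Qed.

Theorem machine_run : exists t,
  tc_state (tm_run machine w t) = inr (inr (play M (leaf w K) (fun=> c0) 0)) /\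
  forall s, in_space (tm_run machine w s).
Proof.
have M0 : 0 < M by rewrite expn_gt0.
have [X' _ Hpl] := @play_steps M (fun=> c0) (leqnn M) (fun _ _ => erefl).
rewrite subnn /= in Hpl.
set r := play _ _ _ _ in Hpl *.
have [t [Et Ht]] : steps (tm_conf0 machine) (cfg (inr r) (vp 0) 0 X' mk0).
  rewrite copy_conf0; apply: (steps1 _ copy_step0); first exact: in_space_copy.
  apply: (steps_trans (@copy_steps 1 isT)).
  apply: steps_trans (zero_steps _ _ M0) _.
  have -> : zeroed (fun=> c0) (0 + ~~ false) = (fun=> c0).
    by apply: functional_extensionality => q; rewrite /zeroed; case: ifP.
  exact: Hpl.
exists t; rewrite /tm_run Et; split=> // s.
case: (ltnP s t) => [/Ht //|Hs].
rewrite -(subnK Hs) iterD Et.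
have -> : iter (s - t) (tm_step w) (cfg (inr r) (vp 0) 0 X' mk0) = cfg (inr r) (vp 0) 0 X' mk0.
  by elim: (s - t) => //= k ->; rewrite /tm_step /tm_halted /=; case: (r).
by apply: in_space_cfg => // i; exact: vp_le.
Qed.
End Run.
End Machine.

(** * The class of W_1.5 inside PSPACE, and the equality *)

Lemma horner_power_shift (m n : nat) :
  ((('X + 2%:P) ^+ m : {poly nat}).[n])%R = n.+2 ^ m.
Proof.
rewrite horner_exp hornerD hornerX hornerC.
rewrite natrXE natrDE; congr (_ ^ _).
by rewrite -[RHS]addn2.
Qed.

Lemma clocked_PSPACE (Sigma : finType) (L : language Sigma) (h : nat)
    (A : mem_automaton Sigma h) (x0 : ma_mem A) :
  stay_free A -> (forall w, clocked A w) -> (forall w, L w <-> ma_accepts A w) -> PSPACE L.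
Proof.
(* The number of halvings [(n + 2) ^ d - 2] has to reach [#|Q| * (n + 2) ^ h], the binary logarithm
   of the number of labellings; the last two digits absorb the subtraction. *)
move=> Hs Hc HL; pose d := (h + #|ma_state A|).+2; have d0 : 0 < d by [].
exists (('X + 2%:P) ^+ (h + d) : {poly nat})%R; exists (h + d).+1, (machine d x0).
have run w := machine_run x0 w d0.
split=> [w|w t j]; last by have [t' [_ H]] := run w; rewrite horner_power_shift; exact: H.
have [t [Et _]] := run w.
have Hpl : play ((size w).+2 ^ (h + d)) (leaf w ((size w).+2 ^ d - 2)) (fun=> c0 x0) 0
    <-> L w.
  rewrite HL (length_eq h w d0) play_leaf; symmetry; apply: (accepts_reach2 Hs (Hc w)).
  have -> : (size w).+2 ^ d = (size w).+2 ^ 2 * ((size w).+2 ^ h * (size w).+2 ^ #|ma_state A|).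
    by rewrite -!expnD /d; congr (_ ^ _); lia.
  have H1 : #|ma_state A| <= (size w).+2 ^ #|ma_state A|.
    by apply: ltnW; apply: ltn_expl.
  have H2 : 0 < (size w).+2 ^ h by rewrite expn_gt0.
  have H3 : 0 < (size w).+2 ^ #|ma_state A| by rewrite expn_gt0.
  have H4 : #|ma_state A| * (size w).+2 ^ h <= (size w).+2 ^ h * (size w).+2 ^ #|ma_state A|.
    by rewrite mulnC leq_mul2l H1 orbT.
  apply: leq_trans H4 _.
  have : 0 < (size w).+2 ^ h * (size w).+2 ^ #|ma_state A| by rewrite muln_gt0 H2.
  move: (_ ^ h * _) => u; rewrite expnS expn1; nia.
split; first by exists t; rewrite /tm_halted Et; case: (play _ _ _ _).
rewrite -Hpl; split=> [Hp|[t' Et']]; first by exists t; rewrite Et Hp.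
have stable s s' : s <= s' -> tm_halted (tm_run (machine d x0) w s) ->
    tm_run (machine d x0) w s' = tm_run (machine d x0) w s.
  move=> Hss Hh; rewrite -(subnK Hss) /tm_run iterD -/(tm_run _ w s).
  by elim: (s' - s) => //= k ->; rewrite /tm_step Hh.
have [Htt|Htt] := leqP t t'.
  have E := stable _ _ Htt; move: Et'; rewrite E /tm_halted Et; last by case: (play _ _ _ _).
  by case: (play _ _ _ _).
have E := stable _ _ (ltnW Htt); move: Et; rewrite E /tm_halted Et' ?eqxx //.
by case: (play _ _ _ _).
Qed.

Lemma R_W15_PSPACE (Sigma : finType) (L : language Sigma) : R_W15 L -> PSPACE L.
Proof.
case=> h [_ [A HL]].
have main (A' : mem_automaton Sigma h) (x : ma_mem A') :
    (forall w, L w <-> ma_accepts A' w) -> PSPACE L.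
  move=> HL'; pose B := sf_automaton A'.
  apply: (@clocked_PSPACE _ _ _ (ck_automaton B) None).
  - by apply: ck_stay_free; exact: sf_stay_free.
  - by move=> w; apply: ck_clocked; exact: sf_stay_free.
  - by move=> w; rewrite HL' -(sf_accepts x) ck_accepts //; exact: sf_stay_free.
(* Without memory symbols there is no memory content and the language is empty; an automaton that
   never accepts then takes the place of [A]. *)
case: (pickP (ma_mem A)) => [x _|H0]; first exact: (main A x).
pose A0 : mem_automaton Sigma h :=
  @MemAutomaton Sigma h unit unit (fun _ _ _ => (tt, [ffun=> Stay], None)) tt set0.
apply: (main A0 tt) => w; rewrite HL; split=> -[mu [t Ht]].
  by have := H0 (mu 0).
by move: Ht; rewrite inE.
Qed.

Theorem theorem2 (Sigma : finType) (L : language Sigma) : R_W15 L <-> PSPACE L.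
Proof. by split; [exact: R_W15_PSPACE|exact: PSPACE_R_W15]. Qed.
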